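(* The law $\mathbb{P}$ of the random interlacement process on $(\Omega,\mathcal{A})$ associated with a transient weighted graph $(\mathcal{G},\mathbf{a})$ satisfies the FKG inequality: for all increasing events $A,B\in\mathcal{A}$, $\mathbb{P}[A\cap B]\ge \mathbb{P}[A]\,\mathbb{P}[B]$.
   Context: Weighted graph and Markov chain. $\mathcal{G}=(\mathbb{V},\mathcal{E})$ is a simple undirected connected locally finite graph with countable vertex set; $\mathbf{a}=(a_{x,y})_{(x,y)\in\mathcal{E}}$ is a family of positive conductances with $a_{x,y}=a_{y,x}$; $a_x:=\sum_{z\sim x}a_{x,z}$. $X=(X_n)_{n\ge 0}$ is the Markov chain on $\mathbb{V}$ with transition probabilities $p_{x,y}=a_{x,y}/a_x$ if $(x,y)\in\mathcal{E}$ and $0$ otherwise; it is assumed to be transient. $P_x$ is the law of $X$ started from $x$. For $K\subset\mathbb{V}$, $\tau_K^+=\inf\{n\ge 1: X_n\in K\}$ ($\inf\emptyset=\infty$). For finite $K$, the equilibrium measure is $e_K(x)=a_xP_x[\tau_K^+=\infty]$ for $x\in K$ and $e_K(x)=0$ otherwise. Trajectories. $W^+$ (resp. $W$) is the set of nearest-neighbour trajectories in $\mathcal{G}$ indexed by $\{0,1,2,\dots\}$ (resp. by $\mathbb{Z}$) that visit each vertex only finitely many times, with the $\sigma$-algebra $\mathcal{W}^+$ (resp. $\mathcal{W}$) generated by the coordinate maps. $W_K\subset W$ is the set of trajectories that hit $K$. $W^*$ is the quotient of $W$ by time-translation ($w\sim w'$ iff $w_{n+k}=w'_n$ for all $n$,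 for some $k\in\mathbb{Z}$), $\pi^*:W\to W^*$ is the projection, $\mathcal{W}^*$ is the $\sigma$-algebra inherited from $\mathcal{W}$ (quotient $\sigma$-algebra), and $W_K^*=\pi^*(W_K)$. Interlacement process. For finite $K$, $\nu_K$ is the measure on $(W,\mathcal{W})$ characterized by $\nu_K(\{w:(w_{-n})_{n\ge 0}\in A,\ w_0=x,\ (w_n)_{n\ge 0}\in B\})=P_x[A\mid\tau_K^+=\infty]\,e_K(x)\,P_x[B]$ for $x\in\mathbb{V}$, $A,B\in\mathcal{W}^+$ (read as $0$ if $e_K(x)=0$). $\nu$ is the unique measure on $(W^*,\mathcal{W}^* )$ such that for every finite $K\subset\mathbb{V}$ the restriction of $\nu$ to $W_K^*$ equals $\nu_K\circ(\pi^* )^{-1}$. $\Omega$ is the set of point measures $\omega=\sum_{i\ge 1}\delta_{w_i^*}$ on $W^*$ with $\omega(W_K^* )<\infty$ for all finite $K$, $\mathcal{A}$ is the $\sigma$-algebra on $\Omega$ generated by the maps $\omega\mapsto\omega(D)$, $D\in\mathcal{W}^*$, and $\mathbb{P}$ is the law on $(\Omega,\mathcal{A})$ of a Poisson point process with intensity measure $\nu$. Order and increasing events. $\Omega$ is ordered by: $\omega\le\omega'$ iff $\omega(D)\le\omega'(D)$ for all $D\in\mathcal{W}^*$. An event $A\in\mathcal{A}$ is increasing if $\omega\in A$ and $\omega\le\omega'$ imply $\omega'\in A$. *)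

(* Defs.v *)
From HB Require Import structures.
From mathcomp Require Import all_boot all_order all_algebra generic_quotient.
From mathcomp Require Import all_classical all_reals all_analysis
  measurable_realfun.
Import Order.TTheory GRing.Theory Num.Theory.

Set Implicit Arguments.
Unset Strict Implicit.
Unset Printing Implicit Defensive.

Local Open Scope quotient_scope.
Local Open Scope classical_set_scope.
Local Open Scope ring_scope.
Local Open Scope ereal_scope.

#[short(type="pcountType")]
HB.structure Definition PointedCountable := {T of Countable T & Pointed T}.

(* Conductances are given by a total function; its values off the edges are
   unconstrained and never used. *)
Record weighted_graph (R : realType) (V : pcountType) := WeightedGraph {
  edge : rel V ;
  edge_sym : symmetric edge ;
  edge_irr : irreflexive edge ;
  edge_connected : forall x y, exists p : seq V, path edge x p /\ last x p = y ;
  edge_locally_finite : forall x, finite_set [set y | edge x y] ;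
  conductance : V -> V -> R ;
  conductance_gt0 : forall x y, edge x y -> (0 < conductance x y)%R ;
  conductance_sym : forall x y, edge x y -> conductance x y = conductance y x }.

Section transition.
Variables (R : realType) (V : pcountType) (G : weighted_graph R V).

Definition vertex_weight (x : V) : R :=
  (\sum_(z \in [set z | edge G x z]) conductance G x z)%R.

Definition transition (x y : V) : R :=
  if edge G x y then (conductance G x y / vertex_weight x)%R else 0%R.

End transition.

(* A generating system of the sigma-algebra generated by the maps X ^~ i, the
   countable set V being discrete. *)
Definition coordinate_system (T I V : Type) (X : T -> I -> V) : set (set T) :=
  \bigcup_i preimage_set_system [set: T] (X ^~ i) [set: set V].

Definition walk (V : pcountType) : Type := nat -> V.

HB.instance Definition _ (V : pcountType) := Pointed.on (walk V).

Section walk_measurable.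
Variable V : pcountType.

Definition walk_system : set (set (walk V)) :=
  coordinate_system (fun (w : walk V) n => w n).

HB.instance Definition _ := @isMeasurable.Build (sigma_display walk_system)
  (walk V) <<s walk_system >> (@sigma_algebra0 _ setT walk_system)
  (@sigma_algebraC _ walk_system) (@sigma_algebra_bigcup _ setT walk_system).

End walk_measurable.

Definition return_time (R : realType) (V : pcountType) (K : set V)
    (w : walk V) : \bar R :=
  ereal_inf [set n%:R%:E | n in [set n : nat | (1 <= n)%N /\ K (w n)]].

Definition no_return (R : realType) (V : pcountType) (K : set V) :
    set (walk V) :=
  [set w | return_time R K w = +oo].

(* The laws P_x of a transient Markov chain on its canonical space. *)
Record transient_chain (R : realType) (V : pcountType)
    (G : weighted_graph R V) := TransientChain {
  law : V -> probability (walk V) R ;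
  law_start : forall x, law x [set w | w 0%N = x] = 1 ;
  law_step : forall x n (y : nat -> V),
    law x [set w | forall i, (i <= n.+1)%N -> w i = y i] =
    law x [set w | forall i, (i <= n)%N -> w i = y i] *
    (transition G (y n) (y n.+1))%:E ;
  law_transient : forall x,
    law x [set w | return_time R [set x] w < +oo] < 1 }.

Definition cond_probability d (T : measurableType d) (R : realType)
    (P : probability T R) (A E : set T) : R :=
  (fine (P (A `&` E)) / fine (P E))%R.

(* Last-exit decomposition: by transience the expected number of visits to a
   vertex is finite, so that almost every walk visits each vertex finitely
   often. *)
Section half_trajectory_existence.
Variables (R : realType) (V : pcountType) (G : weighted_graph R V)
  (X : transient_chain G).

Let cyl n (y : nat -> V) : set (walk V) :=
  [set w | forall i, (i <= n)%N -> w i = y i].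
Let shift n (w : walk V) : walk V := fun i => w (n + i)%N.

Let mcoord n (S : set V) : measurable [set w : walk V | S (w n)].
Proof.
by apply: sub_sigma_algebra; exists n => //; exists S => //; rewrite setTI.
Qed.

Let mcyl n y : measurable (cyl n y).
Proof.
have -> : cyl n y = \bigcap_(i in [set i | (i <= n)%N]) [set w | w i = y i].
  by [].
apply: bigcap_measurable; first by exists 0%N.
by move=> i _; exact: (mcoord i [set y i]).
Qed.

Let cyls : set (set (walk V)) :=
  [set A | [\/ A = setT, A = set0 | exists n y, A = cyl n y]].

Let measurable_cyls : @measurable _ (walk V) = <<s cyls >>.
Proof.
apply/seteqP; split.
- apply: smallest_sub; first exact: smallest_sigma_algebra.
  move=> A [n _ [S _ <-]]; rewrite setTI.
  have -> : (fun w : walk V => w n) @^-1` S =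
      \bigcup_(s : n.+1.-tuple V)
        (if `[< S (nth point s n) >] then cyl n (nth point s) else set0).
    apply/seteqP; split => w /=.
      move=> Sw; exists [tuple w i | i < n.+1] => //.
      have E i : (i <= n)%N -> nth point [tuple w i | i < n.+1] i = w i.
        move=> lin; have lin' : (i < n.+1)%N by [].
        by rewrite -[i]/(nat_of_ord (Ordinal lin')) -tnth_nth tnth_mktuple.
      by case: asboolP => [_ i lin | []]; rewrite E.
    by move=> [s _]; case: asboolP => // Ss /(_ n (leqnn n)) ->.
  apply: (@countable_bigcupT_measurable _ (g_sigma_algebraType cyls)).
    exact: countableP.
  move=> s; case: ifPn => _; last exact: measurable0.
  by apply: sub_sigma_algebra; apply: Or33; exists n, (nth point s).
- apply: smallest_sub; first exact: sigma_algebra_measurable.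
  by move=> A [-> | -> | [n [y ->]]]; [exact: measurableT|exact: measurable0|].
Qed.

Let cylsI : setI_closed cyls.
Proof.
move=> A B [-> | -> | [n [y ->]]]; first by rewrite setTI.
  by rewrite set0I => _; exact: Or32.
move=> [-> | -> | [m [z ->]]].
- by rewrite setIT; apply: Or33; exists n, y.
- by rewrite setI0; exact: Or32.
have [-> | ne] := eqVneq (cyl n y `&` cyl m z) set0; first exact: Or32.
have /set0P[w0 [w0y w0z]] := ne.
apply: Or33; exists (maxn n m), w0; apply/seteqP; split => w /=.
  move=> [wy wz] i; rewrite leq_max => /orP[] l.
    by rewrite wy// w0y.
  by rewrite wz// w0z.
move=> ww0; split => i l; rewrite ww0 ?leq_max ?l ?orbT//.
  exact: w0y.
exact: w0z.
Qed.

Let law_cylD x n m (y : nat -> V) : law X x (cyl (n + m) y) =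
  law X x (cyl n y) * law X (y n) (cyl m (fun i => y (n + i)%N)).
Proof.
elim: m => [|m IH].
  rewrite addn0 [Z in _ * Z](_ : _ = 1) ?mule1// -[RHS](law_start X (y n)).
  congr (law X _ _); apply/seteqP; split => w /=.
    by move=> ->//; rewrite addn0.
  by move=> w0 i; rewrite leqn0 => /eqP ->; rewrite addn0.
rewrite addnS [LHS]law_step [in RHS]law_step muleA -/(cyl _ _) IH.
by rewrite addnS.
Qed.

Let law_cyl0 x m z : z 0%N <> x -> law X x (cyl m z) = 0.
Proof.
move=> zx; apply/eqP; rewrite eq_le measure_ge0 andbT.
have <- : law X x (~` [set w | w 0%N = x]) = 0.
  rewrite probability_setC; last exact: (mcoord 0 [set x]).
  by rewrite law_start subee.
apply: le_measure; rewrite ?inE; [exact: mcyl| |].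
  by apply: measurableC; exact: (mcoord 0 [set x]).
by move=> w /= /(_ 0%N isT) -> .
Qed.

Let mshift n : measurable_fun setT (shift n).
Proof.
apply: (measurability (@walk_system V)) => //.
move=> _ [_ [i _ [S _ <-]] <-]; rewrite !setTI.
exact: (mcoord (n + i) S).
Qed.

Section markov.
Variables (x : V) (n : nat) (y : nat -> V).

Let m1 (A : set (walk V)) := law X x (cyl n y `&` shift n @^-1` A).

Let m10 : m1 set0 = 0.
Proof. by rewrite /m1 preimage_set0 setI0 measure0. Qed.

Let m1_ge0 A : 0 <= m1 A.
Proof. exact: measure_ge0. Qed.

Let m1_sigma_additive : semi_sigma_additive m1.
Proof.
move=> F mF tF mUF; rewrite /m1 preimage_bigcup setI_bigcupr.
have mS A : measurable A -> measurable (cyl n y `&` shift n @^-1` A).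
  move=> mA; apply: measurableI; first exact: mcyl.
  by rewrite -[X in measurable X]setTI; exact: mshift.
apply: measure_semi_sigma_additive.
- by move=> i; exact: mS.
- apply/trivIsetP => /= i j _ _ ij; rewrite setIACA -preimage_setI.
  by move/trivIsetP : tF => /(_ _ _ _ _ ij) ->//; rewrite preimage_set0 setI0.
- by rewrite -setI_bigcupr -preimage_bigcup; exact: mS.
Qed.

HB.instance Definition _ := isMeasure.Build _ _ _ m1 m10 m1_ge0
  m1_sigma_additive.

Lemma markov_cyl A : measurable A -> law X x (cyl n y `&` shift n @^-1` A) =
  law X x (cyl n y) * law X (y n) A.
Proof.
have r0 : (0 <= fine (law X x (cyl n y)))%R by rewrite fine_ge0.
have rE : (fine (law X x (cyl n y)))%:E = law X x (cyl n y).
  by rewrite fineK// fin_num_measure.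
move=> mA; rewrite -/(m1 A).
rewrite -rE.
change (m1 A = mscale (NngNum r0) (law X (y n)) A).
apply: (measure_unique cyls (fun=> setT)) => //.
- by move=> _; exact: Or31.
- by rewrite bigcup_const//; exists 0%N.
- move=> B [-> | -> | [m [z ->]]].
  + by rewrite /= /m1 /mscale /= probability_setT mule1 preimage_setT setIT rE.
  + by rewrite !measure0.
  rewrite /= /m1 /mscale /= rE.
  have [zy|zy] := eqVneq (z 0%N) (y n); last first.
    rewrite (law_cyl0 _ (elimN eqP zy)) mule0.
    rewrite [Z in law X x Z](_ : _ = set0) ?measure0//.
    apply/seteqP; split => // w [/(_ n (leqnn n)) wn /(_ 0%N isT)].
    by rewrite /shift addn0 wn => /esym/eqP; rewrite (negbTE zy).
  pose g i := if (i <= n)%N then y i else z (i - n)%N.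
  have gz i : g (n + i)%N = z i.
    rewrite /g; case: i => [|i]; first by rewrite addn0 leqnn zy.
    by rewrite -[X in (_ <= X)%N]addn0 leq_add2l ltn0 addKn.
  have -> : cyl n y `&` shift n @^-1` cyl m z = cyl (n + m) g.
    apply/seteqP; split => w /=.
      move=> [wy wz] i lei; rewrite /g; case: leqP => [/wy //|ni].
      rewrite -wz /shift ?subnKC//; first exact: ltnW.
      by rewrite leq_subLR.
    move=> wg; split => i lei.
      by rewrite wg ?(leq_trans lei) ?leq_addr// /g lei.
    by rewrite /shift wg ?leq_add2l// gz.
  rewrite law_cylD {2}/g leqnn.
  congr (_ * _); last by congr (law X _ (cyl _ _)); apply/funext.
  by congr (law X x _); apply/seteqP; split => w /= wg i lei;
    rewrite wg// /g lei.
- move=> _; rewrite /= /m1 preimage_setT setIT.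
  by rewrite -rE ltry.
Qed.

End markov.

Section visits.
Variables x v : V.

Let E : set (walk V) := [set w | forall n, (0 < n)%N -> w n <> v].

Let mE : measurable E.
Proof.
have -> : E = \bigcap_(n in [set n | (0 < n)%N]) [set w | (~` [set v]) (w n)].
  by [].
apply: bigcap_measurable; first by exists 1%N.
by move=> i _; exact: mcoord.
Qed.

Let E_gt0 : 0 < law X v E.
Proof.
have -> : E = ~` [set w | return_time R [set v] w < +oo].
  apply/seteqP; split => w /=.
    move=> Ew; apply/negP; rewrite -leNgt leye_eq; apply/eqP.
    by apply/ereal_inf_pinfty => t [n [n0 wn] _]; case: (Ew n n0 wn).
  move=> /negP; rewrite -leNgt leye_eq => /eqP/ereal_inf_pinfty h n n0 wn.
  by have := h _ (ex_intro2 _ _ n (conj n0 wn) erefl).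
have mT : measurable [set w | return_time R [set v] w < +oo].
  have -> : [set w | return_time R [set v] w < +oo] = ~` E; last first.
    exact: measurableC.
  apply/seteqP; split => w /=.
    move=> lt Ew; move: lt; apply/negP; rewrite -leNgt leye_eq; apply/eqP.
    by apply/ereal_inf_pinfty => t [n [n0 wn] _]; case: (Ew n n0 wn).
  move=> nE; rewrite ltey; apply/eqP => /ereal_inf_pinfty h.
  apply: nE => n n0 wn.
  by have := h _ (ex_intro2 _ _ n (conj n0 wn) erefl).
by rewrite probability_setC// sube_gt0; exact: law_transient.
Qed.

Let hist (s : seq V) : set (walk V) :=
  if (s != [::]) && (last v s == v) then cyl (size s).-1 (nth v s) else set0.
Let lastv (s : seq V) : set (walk V) :=
  hist s `&` shift (size s).-1 @^-1` E.
Let F k := oapp hist set0 (pickle_inv k).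
Let D k := oapp lastv set0 (pickle_inv k).

Let mhist s : measurable (hist s).
Proof. by rewrite /hist; case: ifPn => // _; exact: mcyl. Qed.

Let mlastv s : measurable (lastv s).
Proof.
apply: measurableI; first exact: mhist.
by rewrite -[X in measurable X]setTI; exact: mshift.
Qed.

Let law_lastv s : law X x (lastv s) = law X v E * law X x (hist s).
Proof.
rewrite /lastv /hist; case: ifPn => [/andP[s0 /eqP sv]|_]; last first.
  by rewrite set0I measure0 mule0.
by rewrite markov_cyl// nth_last sv muleC.
Qed.

Let histP s w : hist s w -> [/\ (0 < size s)%N, w (size s).-1 = v &
  forall i, (i < size s)%N -> w i = nth v s i].
Proof.
rewrite /hist; case: ifPn => // /andP[s0 /eqP sv] ws.
have s_gt0 : (0 < size s)%N by case: (s) s0.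
split => //.
  by rewrite ws// nth_last sv.
by move=> i lis; apply: ws; rewrite -ltnS prednK.
Qed.

Let lastv_inj s t w : lastv s w -> lastv t w -> s = t.
Proof.
wlog le_st : s t / (size s <= size t)%N => [H ws wt|].
  case: (leqP (size s) (size t)) => l; first exact: H.
  by apply/esym; apply: H => //; exact: ltnW.
move=> [/histP[s0 _ hs] Es] [/histP[t0 wt ht] _].
move: le_st; rewrite leq_eqVlt => /orP[/eqP eq_st | lt_st].
  by apply: (@eq_from_nth _ v) => // i lis; rewrite -hs// ht// -eq_st.
have h : ((size s).-1 < (size t).-1)%N by rewrite -ltnS !prednK.
exfalso; apply: (Es ((size t).-1 - (size s).-1)%N); first by rewrite subn_gt0.
by rewrite /shift subnKC// ltnW.
Qed.

Let mF k : measurable (F k).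
Proof. by rewrite /F; case: pickle_inv => //= s; exact: mhist. Qed.

Let mD k : measurable (D k).
Proof. by rewrite /D; case: pickle_inv => //= s; exact: mlastv. Qed.

Lemma visits_null :
  (law X x).-negligible [set w : walk V | ~ finite_set [set n | w n = v]].
Proof.
have tD : trivIset setT D.
  apply/trivIsetP => i j _ _ ij; apply/seteqP; split => // w [].
  rewrite /D.
  case Ei : (pickle_inv i) => [s|//].
  case Ej : (pickle_inv j) => [t|//] /= ws wt.
  have := pickle_invK (T := seq V) i; rewrite Ei /= => si.
  have := pickle_invK (T := seq V) j; rewrite Ej /= => tj.
  by move/eqP : ij; apply; rewrite -si -tj (lastv_inj ws wt).
have sumD : \sum_(k <oo) law X x (D k) <= 1.
  rewrite -measure_semi_bigcup//; last exact: bigcupT_measurable.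
  by apply: probability_le1; exact: bigcupT_measurable.
have qE : law X v E = (fine (law X v E))%:E by rewrite fineK// fin_num_measure.
have sumF : \sum_(k <oo) law X x (F k) < +oo.
  rewrite ltey; apply/eqP => sumF.
  move: sumD.
  rewrite (_ : \sum_(k <oo) law X x (D k) =
      \sum_(k <oo) ((fine (law X v E))%:E * law X x (F k))); last first.
    apply: eq_eseriesr => k _; rewrite -qE /D /F.
    by case: pickle_inv => [s|] /=; rewrite ?law_lastv// measure0 mule0.
  rewrite nneseriesZl; last by move=> k _; exact: measure_ge0.
  by rewrite sumF -qE gt0_muley// leye_eq.
exists (lim_sup_set F); split.
- by apply: bigcap_measurable => [|k _]; [by exists 0%N|];
    apply: bigcup_measurable => ? _; exact: mF.
- exact: lim_sup_set_cvg0.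
move=> w /= inf N _; apply: contrapT => nF; apply: inf.
pose f n := pickle (mkseq w n.+1).
have finj : injective f.
  move=> i j /(pcan_inj pickleK) /(congr1 size).
  by rewrite !size_mkseq => -[].
apply: (@sub_finite_set _ _ (f @^-1` `I_N)); last first.
  by apply: finite_preimage; [move=> ? ? _ _; exact: finj|exact: finite_II].
move=> n /= wn; rewrite ltnNge; apply/negP => Nf; apply: nF.
exists (f n) => //=; rewrite /F /f pickleK_inv /= /hist.
have lw : last v (mkseq w n.+1) = v.
  by rewrite -nth_last size_mkseq /= nth_mkseq.
rewrite lw eqxx andbT -size_eq0 size_mkseq /= => i lei.
by rewrite nth_mkseq.
Qed.

End visits.

Let nonedge_null x n :
  (law X x).-negligible [set w : walk V | ~~ edge G (w n) (w n.+1)].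
Proof.
pose B (s : seq V) : set (walk V) :=
  if ~~ edge G (nth x s n) (nth x s n.+1) then cyl n.+1 (nth x s) else set0.
apply: (@negligibleS _ _ _ _ (\bigcup_k (oapp B set0 (pickle_inv k)))).
  move=> w /= nw; exists (pickle (mkseq w n.+2)) => //=.
  rewrite pickleK_inv /= /B !nth_mkseq// nw => i lei.
  by rewrite nth_mkseq.
apply: negligible_bigcup => k.
case: pickle_inv => [s|] /=; last exact: negligible_set0.
rewrite /B; case: ifPn => [ne|_]; last exact: negligible_set0.
apply/negligibleP => //.
by rewrite [LHS]law_step /transition (negbTE ne) mule0.
Qed.

Lemma half_trajectory_exists : exists w : nat -> V,
  (forall n, edge G (w n) (w n.+1)) /\ (forall x, finite_set [set n | w n = x]).
Proof.
apply: contrapT => nw.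
pose x : V := point.
suff : (law X x).-negligible [set: walk V].
  move/(negligibleP _ measurableT) => T0.
  have /eqP := probability_setT (law X x).
  by rewrite (T0 : law X x setT = 0) eq_sym onee_eq0.
apply: (@negligibleS _ _ _ _
    ((\bigcup_n [set w : walk V | ~~ edge G (w n) (w n.+1)]) `|`
     (\bigcup_k oapp
       (fun v => [set w : walk V | ~ finite_set [set n | w n = v]])
       set0 (pickle_inv k)))); last first.
  apply: negligibleU.
    by apply: negligible_bigcup => n; exact: nonedge_null.
  apply: negligible_bigcup => k; case: pickle_inv => [v|] /=.
    exact: visits_null.
  exact: negligible_set0.
move=> w _; apply: contrapT => h; apply: nw; exists w; split.
  move=> n; apply: contrapT => /negP hn; apply: h; left; exists n => //.
move=> v; apply: contrapT => hv; apply: h; right; exists (pickle v) => //=.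
by rewrite pickleK_inv.
Qed.

End half_trajectory_existence.

(* A transient chain, rather than the bare graph, is a parameter of the spaces
   of trajectories because transience is what makes them inhabited, as the
   library requires of measurable spaces. *)
Record half_trajectory (R : realType) (V : pcountType)
    (G : weighted_graph R V) (X : transient_chain G) := HalfTrajectory {
  half_trajectory_fun :> nat -> V ;
  half_trajectory_edge : forall n : nat,
    edge G (half_trajectory_fun n) (half_trajectory_fun n.+1) ;
  half_trajectory_finite : forall x,
    finite_set [set n | half_trajectory_fun n = x] }.

Record trajectory (R : realType) (V : pcountType)
    (G : weighted_graph R V) (X : transient_chain G) := Trajectory {
  trajectory_fun :> int -> V ;
  trajectory_edge : forall n : int,
    edge G (trajectory_fun n) (trajectory_fun (n + 1)%R) ;
  trajectory_finite : forall x,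
    finite_set [set n : int | trajectory_fun n = x] }.

Section trajectories.
Variables (R : realType) (V : pcountType) (G : weighted_graph R V)
  (X : transient_chain G).
Local Notation half_trajectory := (half_trajectory X).
Local Notation trajectory := (trajectory X).

Section halves.
Variable w : trajectory.

Lemma forward_edge (n : nat) : edge G (w n%:Z) (w n.+1%:Z).
Proof. by rewrite intS addrC; exact: trajectory_edge. Qed.

Lemma forward_finite x : finite_set [set n : nat | w n%:Z = x].
Proof.
apply: (@finite_preimage _ _ [set n : int | w n = x] Posz).
  by move=> i j _ _ [].
exact: trajectory_finite.
Qed.

Lemma backward_edge (n : nat) : edge G (w (- n%:Z)%R) (w (- n.+1%:Z)%R).
Proof.
rewrite edge_sym [in X in edge G _ X](_ : - n%:Z = - n.+1%:Z + 1)%R.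
  exact: trajectory_edge.
by rewrite intS opprD addrAC addNr add0r.
Qed.

Lemma backward_finite x : finite_set [set n : nat | w (- n%:Z)%R = x].
Proof.
apply: (@finite_preimage _ _ [set n : int | w n = x] (fun n : nat => - n%:Z)%R).
  by move=> i j _ _ /oppr_inj [].
exact: trajectory_finite.
Qed.

Definition forward : half_trajectory :=
  @HalfTrajectory _ _ _ X (fun n : nat => w n%:Z) forward_edge forward_finite.

Definition backward : half_trajectory :=
  @HalfTrajectory _ _ _ X (fun n : nat => w (- n%:Z)%R)
    backward_edge backward_finite.

End halves.

Lemma half_trajectory_inhabited : exists _ : half_trajectory, True.
Proof.
have [w [we wf]] := half_trajectory_exists X.
by exists (HalfTrajectory X we wf).
Qed.

(* The doubled half-trajectory: w_n := u_|n|. *)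
Lemma trajectory_inhabited : exists _ : trajectory, True.
Proof.
have [u _] := half_trajectory_inhabited.
pose w (n : int) : V := u `|n|%N.
have we n : edge G (w n) (w (n + 1)%R).
  rewrite /w; case: n => n.
    by rewrite addrC -intS; exact: half_trajectory_edge.
  have -> : (Negz n + 1 = - n%:Z)%R.
    by rewrite NegzE intS opprD addrAC addNr add0r.
  rewrite abszN edge_sym.
  exact: half_trajectory_edge.
have wf x : finite_set [set n : int | w n = x].
  have uf := half_trajectory_finite u x.
  apply: (@sub_finite_set _ _
      (Posz @` [set n | u n = x] `|` (fun n => - n%:Z)%R @` [set n | u n = x])).
    by move=> [n|n] /= un; [left; exists n|right; exists n.+1].
  by rewrite finite_setU; split; exact: finite_image.
by exists (Trajectory X we wf).
Qed.

HB.instance Definition _ := gen_eqMixin half_trajectory.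
HB.instance Definition _ := gen_choiceMixin half_trajectory.
HB.instance Definition _ :=
  isPointed.Build half_trajectory (projT1 (cid half_trajectory_inhabited)).

Definition half_trajectory_system : set (set half_trajectory) :=
  coordinate_system (fun (w : half_trajectory) (n : nat) => w n).

HB.instance Definition _ :=
  @isMeasurable.Build (sigma_display half_trajectory_system) half_trajectory
    <<s half_trajectory_system >>
    (@sigma_algebra0 _ setT half_trajectory_system)
    (@sigma_algebraC _ half_trajectory_system)
    (@sigma_algebra_bigcup _ setT half_trajectory_system).

HB.instance Definition _ := gen_eqMixin trajectory.
HB.instance Definition _ := gen_choiceMixin trajectory.
HB.instance Definition _ :=
  isPointed.Build trajectory (projT1 (cid trajectory_inhabited)).

Definition trajectory_system : set (set trajectory) :=
  coordinate_system (fun (w : trajectory) (n : int) => w n).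

HB.instance Definition _ :=
  @isMeasurable.Build (sigma_display trajectory_system) trajectory
    <<s trajectory_system >>
    (@sigma_algebra0 _ setT trajectory_system)
    (@sigma_algebraC _ trajectory_system)
    (@sigma_algebra_bigcup _ setT trajectory_system).

Definition shift_equivalent (w w' : trajectory) : bool :=
  `[< exists k : int, forall n : int, w (n + k)%R = w' n >].

Lemma shift_equivalent_refl : reflexive shift_equivalent.
Proof. by move=> w; apply/asboolP; exists 0%R => n; rewrite addr0. Qed.

Lemma shift_equivalent_sym : symmetric shift_equivalent.
Proof.
have sub w w' : shift_equivalent w w' -> shift_equivalent w' w.
  move=> /asboolP[k wk]; apply/asboolP; exists (- k)%R => n.
  by rewrite -wk subrK.
by move=> w w'; apply/idP/idP; exact: sub.
Qed.

Lemma shift_equivalent_trans : transitive shift_equivalent.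
Proof.
move=> w w' w'' /asboolP[k wk] /asboolP[l wl]; apply/asboolP.
by exists (l + k)%R => n; rewrite addrA wk wl.
Qed.

Canonical shift_equivalence := EquivRel shift_equivalent
  shift_equivalent_refl shift_equivalent_sym shift_equivalent_trans.

Definition trajectory_class : Type := {eq_quot shift_equivalence}.

HB.instance Definition _ := Choice.on trajectory_class.
HB.instance Definition _ := Quotient.on trajectory_class.

Definition class_of : trajectory -> trajectory_class := \pi_trajectory_class.

HB.instance Definition _ := isPointed.Build trajectory_class (class_of point).

Definition class_measurable : set (set trajectory_class) :=
  [set D | measurable (class_of @^-1` D)].

Lemma class_measurable0 : class_measurable set0.
Proof. by rewrite /class_measurable /= preimage_set0; exact: measurable0. Qed.

Lemma class_measurableC D : class_measurable D -> class_measurable (~` D).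
Proof. by rewrite /class_measurable /= preimage_setC; exact: measurableC. Qed.

Lemma class_measurable_bigcup (D : (set trajectory_class)^nat) :
  (forall i, class_measurable (D i)) -> class_measurable (\bigcup_i D i).
Proof.
by rewrite /class_measurable /= preimage_bigcup; exact: bigcupT_measurable.
Qed.

HB.instance Definition _ :=
  @isMeasurable.Build (sigma_display class_measurable) trajectory_class
    class_measurable class_measurable0 class_measurableC
    class_measurable_bigcup.

Definition hitting (K : set V) : set trajectory := [set w | exists n, K (w n)].

Definition class_hitting (K : set V) : set trajectory_class :=
  class_of @` hitting K.

Definition equilibrium (K : set V) (x : V) : R :=
  if x \in K then
    (vertex_weight G x * fine (law X x (no_return R K)))%R
  else 0%R.

(* When the conditioning event is null, so that equilibrium K x = 0, the
   conditional probability below is 0 by the convention y / 0 = 0. *)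
Definition is_local_intensity (K : set V)
    (nuK : {measure set trajectory -> \bar R}) :=
  forall (x : V) (A B : set half_trajectory), measurable A -> measurable B ->
  nuK [set w | [/\ A (backward w), w 0%R = x & B (forward w)]] =
  (cond_probability (law X x) (half_trajectory_fun (X := X) @` A)
     (no_return R K))%:E *
  (equilibrium K x)%:E *
  law X x (half_trajectory_fun (X := X) @` B).

Definition is_interlacement_intensity
    (nu : {measure set trajectory_class -> \bar R}) :=
  forall K : set V, finite_set K ->
  exists2 nuK : {measure set trajectory -> \bar R},
    is_local_intensity K nuK &
    forall D : set trajectory_class, measurable D ->
      nu (D `&` class_hitting K) = pushforward nuK class_of D.

(* The family of atoms is countable, possibly finite or empty, and may have
   repetitions. *)
Record configuration := Configuration {
  point_measure :> {measure set trajectory_class -> \bar R} ;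
  configuration_atoms : exists (I : countType) (w : I -> trajectory_class),
    forall D, measurable D ->
      point_measure D = \esum_(i in [set: I]) \d_(w i) D ;
  configuration_finite : forall K : set V, finite_set K ->
    point_measure (class_hitting K) < +oo }.

Lemma configuration_inhabited : exists _ : configuration, True.
Proof.
have atoms : exists (I : countType) (w : I -> trajectory_class),
    forall D, measurable D -> (mzero : {measure set _ -> \bar R}) D =
      \esum_(i in [set: I]) \d_(w i) D.
  exists void, (of_void _) => D _.
  by rewrite (_ : [set: void] = set0) ?esum_set0//; apply/seteqP; split => -[].
have fin : forall K : set V, finite_set K ->
    (mzero : {measure set _ -> \bar R}) (class_hitting K) < +oo.
  by move=> K _; rewrite /= /mzero ltry.
by exists (Configuration atoms fin).
Qed.

HB.instance Definition _ := gen_eqMixin configuration.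
HB.instance Definition _ := gen_choiceMixin configuration.
HB.instance Definition _ :=
  isPointed.Build configuration (projT1 (cid configuration_inhabited)).

Definition configuration_system : set (set configuration) :=
  \bigcup_(D in measurable) preimage_set_system [set: configuration]
    (fun omega : configuration => omega D)
    (measurable : set (set (\bar R))).

HB.instance Definition _ :=
  @isMeasurable.Build (sigma_display configuration_system) configuration
    <<s configuration_system >> (@sigma_algebra0 _ setT configuration_system)
    (@sigma_algebraC _ configuration_system)
    (@sigma_algebra_bigcup _ setT configuration_system).

(* poisson_prob l k is the Poisson distribution of parameter l on nat (the
   Dirac measure at 0 if l = 0): its argument k is a dummy. *)
Definition is_poisson_process (nu : {measure set trajectory_class -> \bar R})
    (P : probability configuration R) :=
  [/\ forall D, measurable D -> nu D < +oo -> forall k : nat,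
        P [set omega : configuration | omega D = k%:R%:E] =
        poisson_prob (fine (nu D)) 0 [set k],
      forall D, measurable D -> nu D = +oo ->
        P [set omega : configuration | omega D = +oo] = 1 &
      forall (n : nat) (D : 'I_n -> set trajectory_class)
        (S : 'I_n -> set (\bar R)),
        (forall i, measurable (D i)) -> trivIset [set: 'I_n] D ->
        (forall i, measurable (S i)) ->
        P (\bigcap_i [set omega : configuration | S i (omega (D i))]) =
        \prod_(i < n) P [set omega : configuration | S i (omega (D i))]].

Definition is_interlacement_law (P : probability configuration R) :=
  exists2 nu : {measure set trajectory_class -> \bar R},
    is_interlacement_intensity nu & is_poisson_process nu P.

Definition configuration_le (omega omega' : configuration) :=
  forall D, measurable D -> omega D <= omega' D.

Definition increasing_event (A : set configuration) :=
  forall omega omega', A omega -> configuration_le omega omega' -> A omega'.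

End trajectories.

(* Main.v *)
From mathcomp Require Import all_boot all_order all_algebra generic_quotient.
From mathcomp Require Import all_classical all_reals all_analysis.
From mathcomp Require Import measurable_realfun ring lra.
Require Import Defs.
Import Order.TTheory GRing.Theory Num.Theory.

(** The inequality holds for every Poisson process whose intensity nu is
    finite on the sets of trajectories hitting a finite set of vertices; it
    rests on the positive association of small independent pieces of the
    process.

    Since the counts of disjoint sets are independent, replacing the
    trajectories of a configuration that lie in a set Q by those of an
    independent copy preserves the law ([mixture_law]). The mean of f over the
    new trajectories is a function [resample f], with the same expectation as
    f, and increasing if f is. If f and g are increasing and two independent
    configurations are comparable on Q outside an event N, then Chebyshev's
    association inequality, applied to the new trajectories, gives E[resample
    f * resample g] <= E[f * g] + p, where p is the probability of N
    ([integral_resampleM]).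

    Comparability fails rarely on small cells. Two given events depend on the
    counts of countably many sets C 0, C 1, ... ([depends_on_countable]).
    These sets cut a set W of finite intensity into finer and finer cells. Two
    configurations that are not comparable on a cell have trajectories there
    that some further C k separates ([comparable_of_not_separated]);
    trajectories that no C k separates may be moved to a single point without
    changing the counts that matter, so nu may have atoms. The probability
    that a cell u, when it is cut into u1 and u2, separates two independent
    configurations is at most 2 nu(u1) nu(u2) = nu(u)^2 - nu(u1)^2 - nu(u2)^2.
    These bounds have a telescoping sum over all generations of cells, so the
    total error of resampling all cells of a generation n, one after the
    other, tends to 0 as n grows ([small_split_mass],
    [integral_resample_cellsM]).

    Resampling all cells of W replaces the indicator of an event about the
    trajectories in W by its probability ([resample_cells_local]). Every event
    is close in probability to an event about the trajectories that hit a
    large finite set of vertices ([measurable_approximable]). So, after all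
    cells have been resampled, the indicators of A and B are close in mean to
    P A and P B, and the mean of their product is close to P A * P B; but this
    mean is at most P (A `&` B) plus the total error ([fkg_approx]). *)

Set Implicit Arguments.
Unset Strict Implicit.
Unset Printing Implicit Defensive.

Local Open Scope classical_set_scope.
Local Open Scope ring_scope.
Local Open Scope ereal_scope.

(** * Operations on configurations *)

Section configuration_operations.
Variables (R : realType) (V : pcountType) (G : weighted_graph R V)
  (X : transient_chain G).
Local Notation T := (trajectory_class X).
Local Notation Om := (configuration X).

Lemma measurable_class_hitting (K : set V) :
  measurable (class_hitting K : set T).
Proof.
rewrite /measurable/= /class_measurable/=.
have -> : class_of (X := X) @^-1` class_hitting K = hitting K.
  apply/seteqP; split => [w [w' [n Kn] /eqmodP /asboolP[k wk]]|w Kw];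
    last by exists w.
  by exists (n - k)%R; rewrite -wk subrK.
have -> : hitting K =
    \bigcup_(n : nat) ((fun w : trajectory X => w n%:Z) @^-1` K `|`
      (fun w : trajectory X => w (- n%:Z)%R) @^-1` K).
  apply/seteqP; split => [w [[n|n] Kn]|w [n _] [Kn|Kn]]; last 2 first.
    by exists n.
    by exists (- n%:Z)%R.
  by exists n => //; left.
  by exists n.+1 => //; right; rewrite /= -NegzE.
apply: bigcupT_measurable => n; apply: measurableU; apply: sub_sigma_algebra.
  by exists n%:Z => //; exists K => //; rewrite setTI.
by exists (- n%:Z)%R => //; exists K => //; rewrite setTI.
Qed.

(** Countable sums of Dirac masses, evaluated on measurable sets: the
    condition on atoms in the definition of a configuration. *)
Definition atomic (mu : set T -> \bar R) := exists (I : countType) (w : I -> T),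
  forall D, measurable D -> mu D = \esum_(i in [set: I]) \d_(w i) D.

(** The atoms in Q, moved by g. *)
Lemma atomic_transport (mu : set T -> \bar R) (g : T -> T) Q :
  measurable_fun setT g -> measurable Q -> atomic mu ->
  atomic (fun D => mu (g @^-1` D `&` Q)).
Proof.
move=> mg mQ [I [w muE]].
exists {i : I | w i \in Q}, (fun i => g (w (val i))) => D mD.
rewrite muE; last first.
  by apply: measurableI => //; rewrite -[X in measurable X]setTI; exact: mg.
rewrite -(@esum_image _ _ _ setT (val : {i : I | w i \in Q} -> I)
  (fun i => \d_(g (w i)) D)); last by move=> i j _ _; exact: val_inj.
rewrite [RHS]esum_mkcond; apply: eq_esum => i _.
rewrite !diracE in_setI.
have [Qi|Qi] := boolP (w i \in Q).
  rewrite andbT ifT; last first.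
    by rewrite inE; exists (Sub i Qi).
  by congr (_ %:R%:E); congr nat_of_bool; apply/idP/idP; rewrite !inE.
rewrite andbF ifF//; apply/negP; rewrite inE => -[[j Qj] _ /= ji].
by move: Qi; rewrite -ji Qj.
Qed.

Lemma atomic_add (mu1 mu2 : set T -> \bar R) :
  atomic mu1 -> atomic mu2 -> atomic (fun D => mu1 D + mu2 D).
Proof.
move=> [I [w muI]] [J [v muJ]].
exists (I + J)%type, (fun k => match k with inl i => w i | inr j => v j end).
move=> D mD; rewrite muI// muJ//.
rewrite [RHS](esumID (range inl)); last by move=> k _; exact: measure_ge0.
congr (_ + _).
  by rewrite setTI esum_image// => i j _ _ [].
have -> : [set: I + J] `&` ~` range inl = range inr.
  apply/seteqP; split => [[i|j] [_ h]|_ [j _ <-]].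
  - by exfalso; apply: h; exists i.
  - by exists j.
  - by split => // -[].
by rewrite esum_image// => i j _ _ [].
Qed.

Lemma configuration_atomic (omega : Om) : atomic omega.
Proof. exact: configuration_atoms. Qed.

Lemma restriction_atoms Q (mQ : measurable Q) (omega : Om) :
  atomic (mrestr omega mQ).
Proof.
by have := atomic_transport (@measurable_id _ _ setT) mQ
  (configuration_atomic omega).
Qed.

Lemma restriction_finite Q (mQ : measurable Q) (omega : Om) (K : set V) :
  finite_set K -> mrestr omega mQ (class_hitting K) < +oo.
Proof.
move=> fK; apply: le_lt_trans (configuration_finite omega fK).
apply: le_measure; rewrite ?inE//.
- by apply: measurableI => //; exact: measurable_class_hitting.
- exact: measurable_class_hitting.
Qed.

(** The trajectories of omega that lie in Q. *)
Definition restriction Q (mQ : measurable Q) (omega : Om) : Om :=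
  Configuration (restriction_atoms mQ omega) (restriction_finite mQ omega).

Lemma superposition_atoms (omega eta : Om) : atomic (measure_add omega eta).
Proof.
have [I [w H]] := atomic_add (configuration_atomic omega)
  (configuration_atomic eta).
by exists I, w => D mD; rewrite -H// -measure_addE.
Qed.

Lemma superposition_finite (omega eta : Om) (K : set V) :
  finite_set K -> measure_add omega eta (class_hitting K) < +oo.
Proof.
by move=> fK; rewrite measure_addE lte_add_pinfty//;
  exact: configuration_finite.
Qed.

(** The union, with multiplicities, of two configurations. *)
Definition superposition (omega eta : Om) : Om :=
  Configuration (superposition_atoms omega eta)
    (superposition_finite omega eta).

Section collapse.
Variables (Q : set T) (mQ : measurable Q) (x : T) (omega : Om).

Let r : {nonneg R} := NngNum (fine_ge0 (measure_ge0 omega Q)).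

Lemma collapse_atoms (Qfin : omega Q < +oo) : atomic (mscale r \d_x).
Proof.
have [I [w H]] := atomic_transport (@measurable_cst _ _ _ _ _ x) mQ
  (configuration_atomic omega).
exists I, w => D mD; rewrite -H// /mscale/= diracE fineK; last first.
  by rewrite ge0_fin_numE.
have [xD|xD] := boolP (x \in D).
  by rewrite mule1 preimage_cst xD setTI.
by rewrite mule0 preimage_cst (negbTE xD) set0I measure0.
Qed.

Lemma collapse_finite (K : set V) :
  finite_set K -> mscale r \d_x (class_hitting K) < +oo.
Proof. by move=> _; rewrite /mscale/= diracE -EFinM ltry. Qed.

(** All the trajectories of omega in Q, finitely many, moved to the single point
    x. *)
Definition collapse (Qfin : omega Q < +oo) : Om :=
  Configuration (collapse_atoms Qfin) collapse_finite.

Lemma collapseE (Qfin : omega Q < +oo) D :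
  collapse Qfin D = if x \in D then omega Q else 0.
Proof.
rewrite /= /mscale/= diracE fineK; last by rewrite ge0_fin_numE.
by case: ifP; rewrite (mule1, mule0).
Qed.

End collapse.

Lemma restrictionE Q (mQ : measurable Q) (omega : Om) D :
  restriction mQ omega D = omega (D `&` Q).
Proof. by []. Qed.

Lemma superpositionE (omega eta : Om) D :
  superposition omega eta D = omega D + eta D.
Proof. exact: measure_addE. Qed.

(** The configuration that is omega off Q and eta in Q. *)
Definition mixture Q (mQ : measurable Q) (omega eta : Om) : Om :=
  superposition (restriction (measurableC mQ) omega) (restriction mQ eta).

Lemma mixtureE Q (mQ : measurable Q) (omega eta : Om) D :
  mixture mQ omega eta D = omega (D `\` Q) + eta (D `&` Q).
Proof. by rewrite superpositionE. Qed.

Arguments restriction : simpl never.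
Arguments superposition : simpl never.
Arguments collapse : simpl never.

Lemma mixture_inside Q (mQ : measurable Q) (omega eta : Om) D :
  D `<=` Q -> mixture mQ omega eta D = eta D.
Proof.
move=> DQ; rewrite mixtureE (setIidl DQ).
by move: DQ; rewrite -setD_eq0 => ->; rewrite measure0 add0e.
Qed.

Lemma mixture_outside Q (mQ : measurable Q) (omega eta : Om) D :
  D `<=` ~` Q -> mixture mQ omega eta D = omega D.
Proof.
move=> DQ; rewrite mixtureE setDE (setIidl DQ).
by move/disjoints_subset : DQ => ->; rewrite measure0 adde0.
Qed.

Lemma measurable_count D : measurable D ->
  measurable_fun setT (fun omega : Om => omega D).
Proof.
move=> mD _ S mS; apply: sub_sigma_algebra.
by exists D => //; exists S.
Qed.

Lemma measurable_mixture Q (mQ : measurable Q) :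
  measurable_fun setT (fun p : Om * Om => mixture mQ p.1 p.2).
Proof.
apply: (measurability (@configuration_system _ _ _ X)) => //.
move=> _ [_ [D mD [S mS <-]] <-].
have mf : measurable_fun setT
  (fun p : Om * Om => p.1 (D `\` Q) + p.2 (D `&` Q)).
  apply: emeasurable_funD.
    apply: (measurableT_comp (f := fun w : Om => w (D `\` Q))) => //.
    by apply: measurable_count; exact: measurableD.
  apply: (measurableT_comp (f := fun w : Om => w (D `&` Q))) => //.
  by apply: measurable_count; exact: measurableI.
have := mf measurableT S mS; congr (measurable _).
by apply/seteqP; split => p; rewrite /preimage/= mixtureE; tauto.
Qed.

End configuration_operations.

(** * Nested partitions into cells *)

(** The Boolean words of length n. *)
Fixpoint codes (n : nat) : seq (seq bool) :=
  if n is m.+1 then map (cons true) (codes m) ++ map (cons false) (codes m)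
  else [:: [::]].

Lemma mem_codes n s : (s \in codes n) = (size s == n).
Proof.
have inj b : injective (cons b : seq bool -> _) by move=> ? ? [].
have F b b' s' n' : b != b' ->
    (b :: s' \in [seq b' :: i | i <- codes n']) = false.
  by move=> bb'; apply/negP => /mapP[u _ [bE _]]; move: bb'; rewrite bE eqxx.
elim: n s => [|n IH] [|b s] //=.
- by rewrite mem_cat; apply/negP => /orP[] /mapP[].
- rewrite mem_cat eqSS -IH; case: b.
    by rewrite mem_map// (F true false)// orbF.
  by rewrite (F false true)// mem_map.
Qed.

Lemma uniq_codes n : uniq (codes n).
Proof.
have inj b : injective (cons b : seq bool -> _) by move=> ? ? [].
elim: n => //= n IH; rewrite cat_uniq !map_inj_uniq// IH/= andbT.
by apply/hasPn => _ /mapP[s _ ->]; apply/negP => /mapP[].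
Qed.

Lemma big_codes_cat (A : nmodType) (F : seq bool -> A) n j :
  (\sum_(s <- codes n) \sum_(t <- codes j) F (t ++ s) =
   \sum_(u <- codes (j + n)) F u)%R.
Proof.
elim: j F => [|j IH] F.
  by apply: eq_bigr => s _; rewrite big_seq1.
rewrite addSn /= big_cat/= !big_map -!IH -big_split/=; apply: eq_bigr => s _.
by rewrite big_cat/= !big_map.
Qed.

Section cells.
Context d (T : measurableType d) (R : realType).
Variables (W : set T) (C : nat -> set T).

(** The cell of W coded by s: the points of W whose membership in C 0, ...,
    C (size s - 1) is prescribed by s, the head of s being the latest choice, so
    that b :: s codes a half of the cell coded by s. *)
Fixpoint cell (s : seq bool) : set T :=
  if s is b :: s' then
    cell s' `&` (if b then C (size s') else ~` C (size s'))
  else W.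

Lemma cell_cons b s :
  cell (b :: s) = cell s `&` (if b then C (size s) else ~` C (size s)).
Proof. by []. Qed.

Lemma cell_cat t s : cell (t ++ s) `<=` cell s.
Proof. by elim: t => //= b t IH x [/IH]. Qed.

Lemma cell_sub s : cell s `<=` W.
Proof. by rewrite -[s]cats0; exact: cell_cat. Qed.

Lemma cell_disjoint s t : size s = size t -> s != t -> cell s `&` cell t = set0.
Proof.
elim: s t => [|b s IH] [|c t]//= [st].
have [->|nst] := eqVneq s t; last first.
  move=> _; apply/seteqP; split => // x [[xs _] [xt _]].
  by rewrite -(IH t st nst).
case: b c => [] [] //= /eqP// _; apply/seteqP; split => // x [[_ xs] [_ xt]].
  exact: xt.
exact: xs.
Qed.

Lemma cell_agree s x y k : cell s x -> cell s y -> (k < size s)%N ->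
  C k x -> C k y.
Proof.
elim: s => //= b s IH [xs xb] [ys yb].
rewrite ltnS leq_eqVlt => /orP[/eqP ->|ks]; last exact: IH.
by case: b xb yb.
Qed.

Lemma cell_cover n x : W x -> exists2 s, s \in codes n & cell s x.
Proof.
move=> Wx; elim: n => [|n [s sn xs]]; first by exists [::].
have [Cx|Cx] := pselect (C (size s) x).
  by exists (true :: s) => //; move: sn; rewrite !mem_codes eqSS.
by exists (false :: s) => //; move: sn; rewrite !mem_codes eqSS.
Qed.

Hypotheses (mW : measurable W) (mC : forall k, measurable (C k)).

Lemma measurable_cell s : measurable (cell s).
Proof.
elim: s => //= b s IH; apply: measurableI => //.
by case: b => //; exact: measurableC.
Qed.

Section measure_of_cells.
Variable mu : {measure set T -> \bar R}.

Lemma measure_cell_split E s : measurable E -> mu (E `&` cell s) =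
  mu (E `&` cell (true :: s)) + mu (E `&` cell (false :: s)).
Proof.
move=> mE; rewrite !cell_cons !setIA -measureU//; last 3 first.
- by apply: measurableI; [apply: measurableI => //; exact: measurable_cell|].
- apply: measurableI; last exact: measurableC.
  by apply: measurableI => //; exact: measurable_cell.
- by rewrite setIACA setICr setI0.
by rewrite -setIUr setUv setIT.
Qed.

Lemma measure_cells n E : measurable E ->
  mu (E `&` W) = \sum_(s <- codes n) mu (E `&` cell s).
Proof.
move=> mE; elim: n => [|n IH]; first by rewrite big_seq1.
rewrite [codes _]/= big_cat/= !big_map -big_split/= IH.
by apply: eq_bigr => s _; exact: measure_cell_split.
Qed.

Hypothesis Wfin : mu W < +oo.

(** The mass of a cell, as a real number. *)
Definition cell_mass (s : seq bool) : R := fine (mu (cell s)).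

Lemma cell_massE s : mu (cell s) = (cell_mass s)%:E.
Proof.
rewrite /cell_mass fineK// ge0_fin_numE//; apply: le_lt_trans Wfin.
by apply: le_measure; rewrite ?inE//; [exact: measurable_cell|exact: cell_sub].
Qed.

Lemma cell_mass_ge0 s : (0 <= cell_mass s)%R.
Proof. exact: fine_ge0. Qed.

Lemma cell_mass_split s :
  cell_mass s = (cell_mass (true :: s) + cell_mass (false :: s))%R.
Proof.
apply: EFin_inj; rewrite EFinD -!cell_massE -[cell s]setTI.
by rewrite measure_cell_split// !setTI.
Qed.

(** Twice the product of the masses of the two halves of a cell: the mass, under
    mu \x mu, of the pairs of points of the cell that C (size s) separates. *)
Definition split_mass (s : seq bool) : R :=
  (2 * cell_mass (true :: s) * cell_mass (false :: s))%R.

Lemma split_mass_ge0 s : (0 <= split_mass s)%R.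
Proof. by rewrite /split_mass !mulr_ge0// cell_mass_ge0. Qed.

(* split_mass s is the decrease of the sum of the squared masses when the cell
   of s is cut in two, so that split_mass has a telescoping sum. *)
Let square_mass n : R := (\sum_(s <- codes n) cell_mass s ^+ 2)%R.

Lemma sum_split_mass n :
  (\sum_(s <- codes n) split_mass s = square_mass n - square_mass n.+1)%R.
Proof.
rewrite /square_mass [codes n.+1]/= big_cat/= !big_map -big_split/=.
rewrite -sumrB; apply: eq_bigr => s _; rewrite (cell_mass_split s) /split_mass.
ring.
Qed.

(** For n large, the split masses of the cells of level n and of all their
    descendants have a small sum. This holds even if mu has atoms, which are
    never cut. *)
Lemma small_split_mass (e : R) : (0 < e)%R -> exists n,
  \sum_(s <- codes n)
    \sum_(0 <= j <oo) (\sum_(t <- codes j) split_mass (t ++ s))%R%:E <= e%:E.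
Proof.
move=> e0.
pose f j : \bar R := (\sum_(s <- codes j) split_mass s)%R%:E.
have f0 j : 0 <= f j by rewrite lee_fin sumr_ge0// => s _;
  exact: split_mass_ge0.
have fE n : \sum_(0 <= j < n) f j = (square_mass 0 - square_mass n)%:E.
  elim: n => [|n IH]; first by rewrite big_geq// subrr.
  by rewrite big_nat_recr//= IH /f sum_split_mass -EFinD; congr (_%:E); ring.
have foo : \sum_(0 <= j <oo) f j < +oo.
  apply: (@le_lt_trans _ _ (square_mass 0)%:E); last exact: ltry.
  apply: lime_le; first by apply: is_cvg_nneseries => *; exact: f0.
  apply: nearW => n; rewrite fE lee_fin lerBlDr lerDl.
  by rewrite sumr_ge0// => s _; exact: sqr_ge0.
have := @nneseries_tail_cvg _ f xpredT foo (fun j _ => f0 j).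
move=> /fine_cvgP[fin /cvgrPdist_le/(_ _ e0)] le.
near \oo => n.
exists n.
rewrite -nneseries_sum; last first.
  move=> s j _; rewrite lee_fin sumr_ge0// => t _; exact: split_mass_ge0.
rewrite (_ : \sum_(0 <= j <oo) _ = \sum_(n <= j <oo) f j).
  have fn : \sum_(n <= j <oo) f j \is a fin_num by near: n.
  rewrite -(fineK fn) lee_fin; apply: le_trans (ler_norm _) _.
  rewrite -normrN -[X in `|X|%R]add0r; near: n; exact: le.
rewrite -(nneseries_addn _ f0).
apply: eq_eseriesr => j _.
by rewrite sumEFin big_codes_cat.
Unshelve. all: by end_near. Qed.

End measure_of_cells.
End cells.

(** * Resampling the trajectories of a set preserves the law *)

Lemma finite_measure_unique d (T : measurableType d) (R : realType)
    (H : set (set T)) (m1 m2 : {measure set T -> \bar R}) :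
  H `<=` measurable -> H setT -> setI_closed H -> m1 setT < +oo ->
  (forall A, H A -> m1 A = m2 A) -> forall A, <<s H >> A -> m1 A = m2 A.
Proof.
move=> Hm HT HI fin eq12 A HA.
apply: (g_sigma_algebra_measure_unique H Hm (fun=> setT)) => //.
by rewrite bigcup_const//; exists 0%N.
Qed.

Section self_product.
Context d (O : measurableType d) (R : realType) (P : probability O R).

(** The law of a pair of independent variables of law P. *)
Definition self_product : probability (O * O)%type R := (P \x P)%E.

Lemma self_productE A B : measurable A -> measurable B ->
  self_product (A `*` B) = P A * P B.
Proof. by move=> mA mB; exact: (product_measure1E P P mA mB). Qed.

(** The law of mix under the product law, as a measure. *)
Lemma self_product_pushforward (mix : O * O -> O) :
  measurable_fun setT mix -> exists M : {measure set O -> \bar R},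
    forall A, M A = self_product (mix @^-1` A).
Proof.
move=> mmix.
by exists (measure_function_pushforward__canonical__measure_function_Measure
  self_product mmix).
Qed.

End self_product.
Arguments self_product : simpl never.

Section law_unique.
Variables (R : realType) (V : pcountType) (G : weighted_graph R V)
  (X : transient_chain G).
Local Notation T := (trajectory_class X).
Local Notation Om := (configuration X).

(** The event that the count of each c i lies in S i. *)
Definition count_event n (c : 'I_n -> set T) (S : 'I_n -> set (\bar R)) :
    set Om :=
  \bigcap_i [set omega : Om | S i (omega (c i))].

Lemma measurable_count_event n (c : 'I_n -> set T) (S : 'I_n -> set (\bar R)) :
  (forall i, measurable (c i)) -> (forall i, measurable (S i)) ->
  measurable (count_event c S).
Proof.
move=> mc mS; apply: fin_bigcap_measurable => // i _.
rewrite -[X in measurable X]setTI.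
exact: (measurable_count (mc i)).
Qed.

Let rects : set (set Om) := [set A | exists n (D : 'I_n -> set T) S,
  [/\ forall i, measurable (D i), forall i, measurable (S i) &
      A = count_event D S]].

Let measurable_rects : @measurable _ Om = <<s rects >>.
Proof.
apply/seteqP; split.
  apply: smallest_sub; first exact: smallest_sigma_algebra.
  move=> _ [D mD [S mS <-]]; apply: sub_sigma_algebra.
  exists 1%N, (fun=> D), (fun=> S); split => //.
  by rewrite setTI; apply/seteqP; split => w //= h;
    [move=> ? _; exact: h|exact: (h ord0)].
apply: smallest_sub; first exact: sigma_algebra_measurable.
by move=> _ [n [D [S [mD mS ->]]]]; exact: measurable_count_event.
Qed.

Let rects_setI : setI_closed rects.
Proof.
move=> _ _ [n [D [S [mD mS ->]]]] [m [D' [S' [mD' mS' ->]]]].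
exists (n + m)%N, (fun i : 'I_(n + m) =>
    match fintype.split i with inl j => D j | inr j => D' j end),
  (fun i : 'I_(n + m) =>
    match fintype.split i with inl j => S j | inr j => S' j end).
split => [i|i|]; try by case: (fintype.split i).
apply/seteqP; split => w.
  by move=> [h h'] i _ /=; case: (fintype.split i) => j; [exact: h|exact: h'].
move=> h; split => i _.
  by have := h (unsplit (inl i)) I; rewrite /= (unsplitK (inl i)).
by have := h (unsplit (inr i)) I; rewrite /= (unsplitK (inr i)).
Qed.

(* The events that prescribe the counts of the c i, for fixed c. *)
Let c_rects n (c : 'I_n -> set T) : set (set Om) :=
  [set A | exists S, (forall i, measurable (S i)) /\ A = count_event c S].

Let measurable_cell_count n (c : 'I_n -> set T) (i : 'I_n) :
  measurable_fun [set: g_sigma_algebraType (c_rects c)]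
    (fun w : Om => w (c i)).
Proof.
move=> _ S mS; rewrite setTI; apply: sub_sigma_algebra.
exists (fun j => if j == i then S else setT); split.
  by move=> j; case: ifP.
apply/seteqP; split => w /=.
  by move=> Sw j _ /=; case: eqP => // ->.
by move=> /(_ i I) /=; rewrite eqxx.
Qed.

(** A finite measure on configurations is determined by the joint laws of the
    counts of finitely many disjoint sets, each inside or outside Q: arbitrary
    sets are unions of cells of a finite partition that refines Q. *)
Lemma configuration_measure_unique (Q : set T) (mQ : measurable Q)
    (m1 m2 : {measure set Om -> \bar R}) : m1 setT < +oo ->
  (forall n (c : 'I_n -> set T) (S : 'I_n -> set (\bar R)),
    (forall i, measurable (c i)) -> trivIset setT c ->
    (forall i, c i `<=` Q \/ c i `<=` ~` Q) ->
    (forall i, measurable (S i)) ->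
    m1 (count_event c S) = m2 (count_event c S)) ->
  forall A, measurable A -> m1 A = m2 A.
Proof.
move=> m1fin m12.
have rectsT : rects setT.
  exists 0%N, (fun=> set0), (fun=> setT); split => //.
  by apply/seteqP; split => // w _ [].
rewrite measurable_rects; apply: finite_measure_unique => //.
  by rewrite measurable_rects; exact: sub_sigma_algebra.
move=> _ [n [D [S [mD mS ->]]]].
(* Q comes first among the sets that cut the cells. *)
pose D' k : set T := if k is k'.+1 then
  if insub k' is Some i then D i else set0 else Q.
have mD' k : measurable (D' k) by case: k => //= k; case: insub.
pose N := size (codes n.+1).
pose c (i : 'I_N) : set T := cell setT D' (nth [::] (codes n.+1) i).
have sz (i : 'I_N) : size (nth [::] (codes n.+1) i) = n.+1.
  by apply/eqP; rewrite -mem_codes mem_nth.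
have mc i : measurable (c i) by exact: measurable_cell.
have cP i k : (k < n.+1)%N -> c i `<=` D' k \/ c i `<=` ~` D' k.
  move=> kn; have [[x [cx Dx]]|no] := pselect (exists x, c i x /\ D' k x).
    by left => y cy; apply: (cell_agree cx cy) => //; rewrite sz.
  by right => y cy Dy; apply: no; exists y.
have tc : trivIset setT c.
  apply/trivIsetP => i j _ _ ij; apply: cell_disjoint; first by rewrite !sz.
  by rewrite nth_uniq// uniq_codes.
have HT : c_rects c setT.
  exists (fun=> setT); split => //; by apply/seteqP; split.
have HI : setI_closed (c_rects c).
  move=> _ _ [S1 [mS1 ->]] [S2 [mS2 ->]].
  exists (fun i => S1 i `&` S2 i); split; first by move=> i; exact: measurableI.
  apply/seteqP; split => w.
    by move=> [h1 h2] i _; split; [exact: h1|exact: h2].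
  by move=> h; split => i _; have [] := h i I.
apply: (finite_measure_unique (H := c_rects c)) => //.
- by move=> _ [S' [mS' ->]]; exact: measurable_count_event.
- by move=> _ [S' [mS' ->]]; apply: m12 => // i; exact: (cP i 0%N).
apply: (@fin_bigcap_measurable _ (g_sigma_algebraType (c_rects c))) => // i _.
have DE (w : Om) : w (D i) =
    \sum_(j < N) if `[< c j `<=` D i >] then w (c j) else 0.
  rewrite -[in LHS](setIT (D i)) (measure_cells measurableT mD' w n.+1 (mD i)).
  rewrite (big_nth [::]) big_mkord; apply: eq_bigr => j _; rewrite -/(c j).
  have D'i : D' i.+1 = D i.
    by rewrite /D' valK.
  case: asboolP => h; first by rewrite setIidr.
  have [h'|h'] := cP j i.+1 (ltn_ord i); rewrite D'i// in h'.
  by rewrite (_ : _ `&` _ = set0) ?measure0//; apply/seteqP;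
    split => // x [Dx /h'].
have -> : [set omega : Om | S i (omega (D i))] = setT `&`
   (fun w : Om => \sum_(j < N) if `[< c j `<=` D i >] then w (c j) else 0) @^-1`
     S i.
  by rewrite setTI; apply/seteqP; split => w /=; rewrite DE.
apply: (@emeasurable_sum _ (g_sigma_algebraType (c_rects c)) R setT _ _
   (fun j (w : Om) => if `[< c j `<=` D i >] then w (c j) else 0)) => //.
move=> j; case: (asboolP (c j `<=` D i)) => _; last exact: measurable_cst.
exact: measurable_cell_count.
Qed.

End law_unique.

Section resampling.
Variables (R : realType) (V : pcountType) (G : weighted_graph R V)
  (X : transient_chain G).
Local Notation T := (trajectory_class X).
Local Notation Om := (configuration X).
Variable P : probability Om R.

(** The counts of disjoint sets are independent. *)
Definition independent_counts :=
  forall (n : nat) (c : 'I_n -> set T) (S : 'I_n -> set (\bar R)),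
    (forall i, measurable (c i)) -> trivIset [set: 'I_n] c ->
    (forall i, measurable (S i)) ->
    P (count_event c S) =
    \prod_(i < n) P [set omega : Om | S i (omega (c i))].

Hypothesis indP : independent_counts.

(** Replacing the trajectories in Q by those of an independent copy preserves
    the law. *)
Lemma mixture_law Q (mQ : measurable Q) A : measurable A ->
  self_product P ((fun p : Om * Om => mixture mQ p.1 p.2) @^-1` A) = P A.
Proof.
move=> mA; have [M ME] := self_product_pushforward P (measurable_mixture mQ).
rewrite -ME; apply/esym.
pose P0 : {measure set Om -> \bar R} := P.
rewrite -[LHS]/(P0 A).
apply: (configuration_measure_unique mQ (m1 := P0) (m2 := M)) => //.
  by rewrite -[X in X < _]/(P setT) probability_setT ltry.
move=> n c S mc tc cQ mS; rewrite -[LHS]/(P (count_event c S)).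
(* Each c i lies in Q, where the count is that of eta, or outside Q, where it is
   that of omega. *)
pose S1 i := if `[< c i `<=` Q >] then setT else S i.
pose S2 i := if `[< c i `<=` Q >] then S i else setT.
have mS1 i : measurable (S1 i) by rewrite /S1; case: ifP.
have mS2 i : measurable (S2 i) by rewrite /S2; case: ifP.
have -> : M (count_event c S) =
  self_product P (count_event c S1 `*` count_event c S2).
  rewrite ME; rewrite (_ : _ @^-1` _ = count_event c S1 `*` count_event c S2)//.
  apply/seteqP; split => -[w1 w2] /=.
    move=> h; split => i _ /=; rewrite /S1 /S2; case: asboolP => // ciQ.
      have [//|ciQ'] := cQ i.
      by have := h i I; rewrite /= mixture_outside.
    by have := h i I; rewrite /= mixture_inside.
  move=> [h1 h2] i _ /=.
  have := h1 i I; have := h2 i I; rewrite /= /S1 /S2; case: asboolP => ciQ /=.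
    by rewrite mixture_inside.
  have [//|ciQ'] := cQ i.
  by rewrite mixture_outside.
rewrite self_productE; try exact: measurable_count_event.
rewrite !indP// -big_split/=; apply: eq_bigr => i _.
rewrite /S1 /S2; case: asboolP => _.
  by rewrite [X in P X * _](_ : _ = setT) ?probability_setT ?mul1e//;
    apply/seteqP; split.
by rewrite [X in _ * P X](_ : _ = setT) ?probability_setT ?mule1//;
  apply/seteqP; split.
Qed.

End resampling.

(** * Counts of a Poisson process and approximation by local events *)

Lemma ereal_cvg0_le (R : realType) (u : nat -> \bar R) (e : R) :
  u n @[n --> \oo] --> 0 -> (0 < e)%R -> exists n, u n <= e%:E.
Proof.
move=> /fine_cvgP[fin /cvgrPdist_le + ] e0 => /(_ _ e0) le.
near \oo => n; exists n.
have fn : u n \is a fin_num by near: n.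
rewrite -(fineK fn) lee_fin; apply: le_trans (ler_norm _) _.
by rewrite -normrN -[X in `|X|%R]add0r; near: n.
Unshelve. all: by end_near. Qed.

Section exhaustion.
Variables (R : realType) (V : pcountType) (G : weighted_graph R V)
  (X : transient_chain G).
Local Notation T := (trajectory_class X).

(** The trajectories that hit one of the finitely many vertices whose code, by
    pickle, is less than n. *)
Definition exhaustion (n : nat) : set T :=
  class_hitting [set x : V | (pickle x < n)%N].

Lemma finite_exhaustion n : finite_set [set x : V | (pickle x < n)%N].
Proof.
have := @finite_preimage _ _ `I_n (pickle : V -> nat).
by apply => //; move=> x y _ _; exact: (pcan_inj pickleK).
Qed.

Lemma measurable_exhaustion n : measurable (exhaustion n).
Proof. exact: measurable_class_hitting. Qed.

Lemma exhaustion_subset m n : (m <= n)%N -> exhaustion m `<=` exhaustion n.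
Proof.
move=> mn _ [w [k wk] <-]; exists w => //; exists k.
exact: leq_trans wk mn.
Qed.

Lemma exhaustion_cover : \bigcup_n exhaustion n = [set: T].
Proof.
apply/seteqP; split => // t _; exists (pickle (repr t 0%R)).+1 => //.
exists (repr t); last exact: reprK.
by exists 0%R => /=.
Qed.

End exhaustion.
Arguments exhaustion {R V G} X n.

Section dependence.
Variables (R : realType) (V : pcountType) (G : weighted_graph R V)
  (X : transient_chain G).
Local Notation T := (trajectory_class X).
Local Notation Om := (configuration X).

(** f is a function of the counts of the sets in F. *)
Definition depends_on (Y : Type) (F : set (set T)) (f : Om -> Y) :=
  forall omega eta : Om, (forall D, F D -> omega D = eta D) ->
    f omega = f eta.

Lemma depends_on_sub Y (F F' : set (set T)) (f : Om -> Y) :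
  F `<=` F' -> depends_on F f -> depends_on F' f.
Proof. by move=> FF' df w v wv; apply: df => D /FF'; exact: wv. Qed.

Lemma depends_on_setC F (A : set Om) : depends_on F A -> depends_on F (~` A).
Proof. by move=> dA w v /dA; rewrite /setC/= => ->. Qed.

Lemma depends_on_bigcup F (A : (set Om)^nat) :
  (forall i, depends_on F (A i)) -> depends_on F (\bigcup_i A i).
Proof.
move=> dA w v wv; apply/propeqP; split => -[i _ Ai]; exists i => //.
  by rewrite -(dA i _ _ wv).
by rewrite (dA i _ _ wv).
Qed.

(** An event involves only countably many counts. *)
Lemma depends_on_countable (A : set Om) : measurable A ->
  exists C : nat -> set T,
    (forall k, measurable (C k)) /\ depends_on (range C) A.
Proof.
move: A; apply: smallest_sub.
  split.
  - by exists (fun=> set0); split.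
  - move=> A [C [mC dA]]; exists C; split => //.
    by rewrite setTD; exact: depends_on_setC.
  - move=> A /choice[C CP].
    exists (fun k => if unpickle k is Some ij then C ij.1 ij.2 else set0);
      split.
      by move=> k; case: unpickle => // -[i j]; have [mC _] := CP i; exact: mC.
    apply: depends_on_bigcup => i; have [_ dA] := CP i.
    apply: depends_on_sub dA => _ [j _ <-].
    by exists (pickle (i, j)) => //; rewrite pickleK.
move=> _ [D mD [S mS <-]]; exists (fun=> D); split => // w v wv.
by rewrite setTI /preimage/= wv//; exists 0%N.
Qed.

End dependence.

Section poisson.
Variables (R : realType) (V : pcountType) (G : weighted_graph R V)
  (X : transient_chain G).
Local Notation T := (trajectory_class X).
Local Notation Om := (configuration X).
Variables (nu : {measure set T -> \bar R}) (P : probability Om R).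
Hypothesis poiP : is_poisson_process nu P.

Lemma poisson_independent : independent_counts P.
Proof. by case: poiP => _ _ h n c S mc tc mS; exact: h. Qed.

Lemma measurable_count_eq D (a : \bar R) : measurable D ->
  measurable [set omega : Om | omega D = a].
Proof.
move=> mD; rewrite -[X in measurable X]setTI.
by apply: (measurable_count mD measurableT (_ : measurable [set a])).
Qed.

Lemma measurable_count_neq0 D : measurable D ->
  measurable [set omega : Om | omega D != 0].
Proof.
move=> mD.
have -> : [set omega : Om | omega D != 0] = ~` [set omega : Om | omega D = 0].
  by apply/seteqP; split => w /= /eqP.
by apply: measurableC; exact: measurable_count_eq.
Qed.

(** The intensity of class_hitting K is finite because a configuration has
    finitely many trajectories hitting K, whereas the count of a set of infinite
    intensity is almost surely infinite. *)
Lemma poisson_intensity_finite (K : set V) :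
  finite_set K -> nu (class_hitting K) < +oo.
Proof.
move=> fK; rewrite ltey; apply/eqP => nuK.
have [_ h _] := poiP; have := h _ (measurable_class_hitting (X := X) K) nuK.
rewrite (_ : [set _ | _] = set0) ?measure0; last first.
  apply/seteqP; split => // w /= wK.
  by have := configuration_finite w fK; rewrite wK.
by move/eqP; rewrite eq_sym onee_eq0.
Qed.

(** The Poisson process has a trajectory in a set with probability at most the
    intensity of the set. *)
Lemma poisson_hit_le D : measurable D ->
  P [set omega : Om | omega D != 0] <= nu D.
Proof.
move=> mD; have [nuD|] := ltP (nu D) +oo; last by rewrite leye_eq => /eqP ->;
  exact: leey.
have -> : [set omega : Om | omega D != 0] = ~` [set omega : Om | omega D = 0].
  by apply/seteqP; split => w /= /eqP.
rewrite probability_setC; last exact: measurable_count_eq.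
have [h _ _] := poiP; rewrite (h D mD nuD 0%N).
have -> : nu D = (fine (nu D))%:E by rewrite fineK// ge0_fin_numE.
set r := fine (nu D); have r0 : (0 <= r)%R by exact: fine_ge0.
rewrite /= /poisson_prob; case: ifPn => [r_gt0|_].
  rewrite esum_set1; last by rewrite lee_fin poisson_pmf_ge0.
  rewrite /poisson_pmf r_gt0 expr0 fact0 invr1 !mul1r -EFinB lee_fin.
  by have := expR_ge1Dx (- r)%R; lra.
by rewrite diracE mem_set//= subee.
Qed.

Lemma exhaustion_tail_cvg D : measurable D -> nu D < +oo ->
  nu (D `\` exhaustion X n) @[n --> \oo] --> 0.
Proof.
move=> mD nuD.
rewrite -(measure0 nu) -(_ : \bigcap_n (D `\` exhaustion X n) = set0).
  apply: nonincreasing_cvg_mu.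
  - by apply: le_lt_trans nuD; apply: le_measure; rewrite ?inE//;
      apply: measurableD => //; exact: measurable_exhaustion.
  - by move=> n; apply: measurableD => //; exact: measurable_exhaustion.
  - apply: bigcap_measurable; first by exists 0%N.
    by move=> n _; apply: measurableD => //; exact: measurable_exhaustion.
  - move=> m n mn; apply/subsetPset => x [Dx nx]; split => //.
    by move=> /(exhaustion_subset mn).
apply/seteqP; split => // x h.
have [n _ xn] : (\bigcup_n exhaustion X n) x by rewrite exhaustion_cover.
by have [_] := h n I; apply.
Qed.

(** The measurable subsets of D. An event that depends on local_sets D is an
    event about the trajectories in D. *)
Definition local_sets (D : set T) : set (set T) :=
  [set E | measurable E /\ E `<=` D].

(** A is, up to an event of arbitrarily small probability, an event about the
    trajectories that hit a finite set of vertices. *)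
Definition approximable (A : set Om) := forall e : R, (0 < e)%R ->
  exists n (B : set Om), [/\ measurable B,
    depends_on (local_sets (exhaustion X n)) B &
    P (A `\` B `|` B `\` A) <= e%:E].

Let local_mono m n : (m <= n)%N ->
  local_sets (exhaustion X m) `<=` local_sets (exhaustion X n).
Proof.
by move=> mn D [mD Dm]; split => //; apply: subset_trans Dm _;
  exact: exhaustion_subset.
Qed.

Lemma approximable_count D S : measurable D -> measurable S ->
  approximable [set omega : Om | S (omega D)].
Proof.
move=> mD mS e e0.
have mSD E : measurable E -> measurable [set omega : Om | S (omega E)].
  by move=> mE; rewrite -[X in measurable X]setTI;
    exact: (measurable_count mE measurableT).
have [nuD|] := ltP (nu D) +oo; last first.
  rewrite leye_eq => /eqP nuD.
  (* The event is almost sure or null, according to whether +oo is in S. *)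
  have [_ /(_ D mD nuD) h _] := poiP.
  exists 0%N, (if `[< S +oo >] then setT else set0); split.
  - by case: ifP.
  - by case: ifP.
  - apply: (@le_trans _ _ 0); last by rewrite lee_fin ltW.
    have <- : P (~` [set omega : Om | omega D = +oo]) = 0.
      by rewrite probability_setC ?h ?subee//; exact: measurable_count_eq.
    apply: le_measure; rewrite ?inE.
    + by apply: measurableU; apply: measurableD; (try exact: mSD); case: ifP.
    + by apply: measurableC; exact: measurable_count_eq.
    + case: asboolP => Soo w /= [[Sw nw]|[nw Sw]] wD.
      * exact: nw.
      * by apply: Sw; rewrite wD.
      * by apply: Soo; rewrite -wD.
      * exact: nw.
have [n nuDn] := ereal_cvg0_le (exhaustion_tail_cvg mD nuD) e0.
have mDn : measurable (D `\` exhaustion X n).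
  by apply: measurableD => //; exact: measurable_exhaustion.
have mDI : measurable (D `&` exhaustion X n).
  by apply: measurableI => //; exact: measurable_exhaustion.
exists n, [set omega : Om | S (omega (D `&` exhaustion X n))]; split.
- exact: mSD.
- by move=> w v wv /=; rewrite wv.
- apply: le_trans nuDn; apply: le_trans (poisson_hit_le mDn).
  apply: le_measure; rewrite ?inE.
  + by apply: measurableU; apply: measurableD; exact: mSD.
  + exact: measurable_count_neq0.
  + move=> w /= h; apply/eqP => w0.
    have : w D = w (D `&` exhaustion X n).
      rewrite -[in LHS](setUIDK D (exhaustion X n)) measureU//.
        by rewrite /= w0 adde0.
      by apply/seteqP; split => // x [[_ ?] [_ ?]].
    by move=> wD; rewrite wD in h; tauto.
Qed.

Let measurable_sdiff (A B : set Om) : measurable A -> measurable B ->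
  measurable (A `\` B `|` B `\` A).
Proof. by move=> mA mB; apply: measurableU; exact: measurableD. Qed.

Lemma approximable_setC A : approximable A -> approximable (~` A).
Proof.
move=> aA e e0; have [n [B [mB dB PB]]] := aA e e0.
exists n, (~` B); split; [exact: measurableC|exact: depends_on_setC|].
by rewrite !setDE !setCK setUC ![~` _ `&` _]setIC -!setDE.
Qed.

Lemma approximable_setU A A' : measurable A -> measurable A' ->
  approximable A -> approximable A' -> approximable (A `|` A').
Proof.
move=> mA mA' aA aA' e e0; have e2 : (0 < e / 2)%R by rewrite divr_gt0.
have [n [B [mB dB PB]]] := aA _ e2.
have [m [B' [mB' dB' PB']]] := aA' _ e2.
exists (maxn n m), (B `|` B'); split.
- exact: measurableU.
- move=> w v wv; rewrite /setU/=.
  congr (_ \/ _); [apply: dB|apply: dB'] => D hD; apply: wv;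
    apply: local_mono hD.
    exact: leq_maxl.
  exact: leq_maxr.
- have -> : e%:E = (e / 2)%:E + (e / 2)%:E by rewrite -EFinD -splitr.
  apply: le_trans (leeD PB PB').
  apply: le_trans (measureU2 P (measurable_sdiff mA mB)
    (measurable_sdiff mA' mB')).
  apply: le_measure; rewrite ?inE.
  + by apply: measurable_sdiff; exact: measurableU.
  + by apply: measurableU; exact: measurable_sdiff.
  + by move=> w /=; rewrite /setU /setD/=; tauto.
Qed.

Lemma approximable_bigcup (A : (set Om)^nat) :
  (forall i, measurable (A i)) -> (forall i, approximable (A i)) ->
  approximable (\bigcup_i A i).
Proof.
move=> mA aA e e0; have e2 : (0 < e / 2)%R by rewrite divr_gt0.
pose U n := \bigcup_(i < n) A i.
have mU n : measurable (U n) by apply: bigcup_measurable => ? _.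
have aU n : approximable (U n).
  elim: n => [|n IH].
    rewrite /U bigcup0//.
    by move=> e' e'0; exists 0%N, set0; split => //;
      rewrite setDv setU0 measure0 lee_fin ltW.
  have -> : U n.+1 = U n `|` A n by rewrite /U bigcup_mkord big_ord_recr/=
    -bigcup_mkord.
  exact: approximable_setU.
have mUA : measurable (\bigcup_i A i) by exact: bigcupT_measurable.
have cvgD : P (\bigcup_i A i `\` U n) @[n --> \oo] --> 0.
  rewrite -(measure0 P) -(_ : \bigcap_n (\bigcup_i A i `\` U n) = set0).
    apply: nonincreasing_cvg_mu.
    - by rewrite (le_lt_trans (probability_le1 _ _)) ?ltry//;
        exact: measurableD.
    - by move=> n; exact: measurableD.
    - by apply: bigcap_measurable; [exists 0%N|move=> n _; exact: measurableD].
    - move=> m n mn; apply/subsetPset => x [Ax nx]; split => // -[i /= im Ai].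
      by apply: nx; exists i => //=; exact: leq_trans im mn.
  apply/seteqP; split => // x h; have [[i _ Ai] _] := h 0%N I.
  by have [_] := h i.+1 I; apply; exists i => /=.
have [n Pn] := ereal_cvg0_le cvgD e2.
have [m [B [mB dB PB]]] := aU n _ e2.
exists m, B; split => //.
have -> : e%:E = (e / 2)%:E + (e / 2)%:E by rewrite -EFinD -splitr.
apply: le_trans (leeD PB Pn).
apply: le_trans (measureU2 P (measurable_sdiff (mU n) mB)
  (measurableD mUA (mU n))).
apply: le_measure; rewrite ?inE.
- exact: measurable_sdiff.
- by apply: measurableU; [exact: measurable_sdiff|exact: measurableD].
- move=> w /= [[Aw Bw]|[Bw Aw]].
    by have [Uw|Uw] := pselect (U n w); [left; left|right].
  by left; right; split => // -[i _ Aiw]; apply: Aw; exists i.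
Qed.

Lemma measurable_approximable A : measurable A -> approximable A.
Proof.
suff : (measurable : set (set Om)) `<=` measurable `&` approximable.
  by move=> h mA; have [] := h _ mA.
apply: smallest_sub; last first.
  move=> _ [D mD [S mS <-]]; split.
    by apply: sub_sigma_algebra; exists D => //; exists S.
  by rewrite setTI; exact: approximable_count.
split.
- by split => // e e0; exists 0%N, set0; split => //;
    rewrite setDv setU0 measure0 lee_fin ltW.
- move=> A' [mA' aA]; rewrite setTD; split; first exact: measurableC.
  exact: approximable_setC.
- move=> F h; split; first by apply: bigcupT_measurable => i; case: (h i).
  by apply: approximable_bigcup => i; case: (h i).
Qed.

End poisson.

(** * Comparison of two configurations on a cell *)

Section comparison.
Variables (R : realType) (V : pcountType) (G : weighted_graph R V)
  (X : transient_chain G).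
Local Notation T := (trajectory_class X).
Local Notation Om := (configuration X).
Variables (W : set T) (C : nat -> set T).
Hypotheses (mW : measurable W) (mC : forall k, measurable (C k)).

(** The sigma-algebra generated by W and the C k; it contains the cells. *)
Definition cell_sets : set (set T) := <<s range C `|` [set W] >>.

Lemma cell_sets_measurable : cell_sets `<=` measurable.
Proof.
apply: smallest_sub; first exact: sigma_algebra_measurable.
by move=> D [[k _ <-]|->].
Qed.

Lemma cell_sets_cell s : cell_sets (cell W C s).
Proof.
have mW' : @measurable _ (g_sigma_algebraType (range C `|` [set W])) W.
  by apply: sub_sigma_algebra; right.
have mC' k : @measurable _ (g_sigma_algebraType (range C `|` [set W])) (C k).
  by apply: sub_sigma_algebra; left; exists k.
exact: (measurable_cell mW' mC').
Qed.

Lemma cell_sets_setD D E : cell_sets D -> cell_sets E -> cell_sets (D `\` E).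
Proof. exact: (@measurableD _ (g_sigma_algebraType (range C `|` [set W]))). Qed.

(** f increases with the configuration. *)
Definition monotone_functional (f : Om -> \bar R) :=
  forall omega eta, configuration_le omega eta -> f omega <= f eta.

Let mcell s := measurable_cell mW mC s.

(** The configuration has a trajectory in the cell of u. *)
Definition hit (u : seq bool) : set Om := [set omega | omega (cell W C u) != 0].

Lemma measurable_hit u : measurable (hit u).
Proof. exact: measurable_count_neq0. Qed.

(** The two configurations have trajectories in opposite halves of the cell of
    u. *)
Definition split_event (u : seq bool) : set (Om * Om) :=
  hit (true :: u) `*` hit (false :: u) `|` hit (false :: u) `*` hit (true :: u).

(** The cell of s, or one of its descendants, is split between the two
    configurations. *)
Definition separated (s : seq bool) : set (Om * Om) :=
  \bigcup_i \big[setU/set0]_(t <- codes i) split_event (t ++ s).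

Lemma measurable_split_event u : measurable (split_event u).
Proof. by apply: measurableU; apply: measurableX; exact: measurable_hit. Qed.

Lemma measurable_separated s : measurable (separated s).
Proof.
apply: bigcupT_measurable => i; apply: bigsetU_measurable => t _.
exact: measurable_split_event.
Qed.

Lemma not_separated s eta eta' : ~ separated s (eta, eta') ->
  forall t, ~ split_event (t ++ s) (eta, eta').
Proof.
move=> ns t st; apply: ns; exists (size t) => //.
rewrite -bigcup_seq; exists t => //=.
by rewrite mem_codes.
Qed.

(** If neither a cell nor a descendant of it is split, then, unless one of the
    configurations misses the cell, all their trajectories in the cell lie in
    a single atom q of cell_sets. The counts of the sets in cell_sets do not
    change when these trajectories are moved to one point of q, after which
    the two configurations are ordered according to their numbers of
    trajectories. The direction of the comparison is the same for all f. *)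
Lemma comparable_of_not_separated s eta eta' :
    (forall omega : Om, omega W < +oo) ->
    ~ separated s (eta, eta') -> eta (cell W C s) <= eta' (cell W C s) ->
  forall omega f, monotone_functional f -> depends_on cell_sets f ->
    f (mixture (mcell s) omega eta) <= f (mixture (mcell s) omega eta').
Proof.
move=> Wfin /not_separated ns le_ee omega f incf depf.
set Q := cell W C s in le_ee *.
have mQ : measurable Q by exact: mcell.
have [eta0|eta0] := eqVneq (eta Q) 0.
  apply: incf => D mD; rewrite !mixtureE; apply: leeD => //.
  rewrite (_ : eta _ = 0) ?measure_ge0//; apply/eqP;
    rewrite eq_le measure_ge0 andbT -eta0.
  by apply: le_measure; rewrite ?inE//; exact: measurableI.
have eta'0 : eta' Q != 0.
  by rewrite gt_eqF//; apply: lt_le_trans le_ee; rewrite lt0e eta0 measure_ge0.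
(* At every level below s, both configurations charge a common descendant and
   vanish on the rest of the cell. *)
have deep i : exists t, [/\ size t = i, eta (Q `\` cell W C (t ++ s)) = 0,
    eta' (Q `\` cell W C (t ++ s)) = 0, eta (cell W C (t ++ s)) != 0 &
    eta' (cell W C (t ++ s)) != 0].
  elim: i => [|i [t [sz e1 e2 h1 h2]]].
    by exists [::]; rewrite /= setDv !measure0.
  set u := t ++ s in e1 e2 h1 h2 *.
  have sp (w : Om) : w (cell W C u) =
    w (cell W C (true :: u)) + w (cell W C (false :: u)).
    have := @measure_cell_split _ _ R W C mW mC w setT u measurableT.
    by rewrite !setTI.
  have out (w : Om) b : w (Q `\` cell W C u) = 0 ->
      w (cell W C (~~ b :: u)) = 0 -> w (Q `\` cell W C (b :: u)) = 0.
    move=> w1 w2; apply/eqP; rewrite eq_le measure_ge0 andbT.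
    rewrite -[leRHS]adde0 -[X in X + _]w1 -[X in _ + X]w2.
    apply: le_trans (measureU2 w (measurableD mQ (mcell u))
      (mcell (~~ b :: u))).
    apply: le_measure; rewrite ?inE.
    - exact: measurableD.
    - by apply: measurableU => //; exact: measurableD.
    - move=> x [Qx nx]; have [ux|ux] := pselect (cell W C u x); last by left.
      right; split => //; case: b w2 nx => /= _ nx.
        by move=> Cx; apply: nx.
      by apply: contrapT => Cx; apply: nx.
  have zero b : eta (cell W C (b :: u)) != 0 -> eta' (cell W C (~~ b :: u)) = 0.
    move=> hb; apply/eqP; apply: contrapT => /negP hb'; apply: (ns t).
    by case: b hb hb' => hb hb'; [left|right].
  have zero' b : eta' (cell W C (b :: u)) != 0 ->
      eta (cell W C (~~ b :: u)) = 0.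
    move=> hb; apply/eqP; apply: contrapT => /negP hb'; apply: (ns t).
    by case: b hb hb' => hb hb'; [right|left].
  have [b hb] : exists b, eta (cell W C (b :: u)) != 0.
    have [e0|] := eqVneq (eta (cell W C (true :: u))) 0; last by exists true.
    by exists false; move: h1; rewrite sp e0 add0e.
  have z1 := zero b hb.
  have hb' : eta' (cell W C (b :: u)) != 0.
    move: h2; rewrite sp; case: (b) z1 => /= ->; by rewrite (adde0, add0e).
  have z2 := zero' b hb'.
  exists (b :: t); rewrite /= sz -/u; split => //; exact: out.
have /choice[t tP] := deep.
pose q := \bigcap_i cell W C (t i ++ s).
have mq : measurable q by apply: bigcap_measurable => [|i _];
  [exists 0%N|exact: mcell].
have qQ : q `<=` Q by move=> x /(_ 0%N I); exact: cell_cat.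
have conc (w : Om) : (forall i, w (Q `\` cell W C (t i ++ s)) = 0) ->
    w (Q `\` q) = 0.
  move=> h; rewrite (_ : Q `\` q = \bigcup_i (Q `\` cell W C (t i ++ s))).
    apply/eqP; rewrite -measure_le0.
    apply: (@le_trans _ _ (\sum_(i <oo) w (Q `\` cell W C (t i ++ s)))).
      apply: measure_sigma_subadditive => // [i|]; first exact: measurableD.
      by apply: bigcupT_measurable => i; exact: measurableD.
    by rewrite eseries0// => i _ _; exact: h.
  by rewrite /q setDE setC_bigcap setI_bigcupr.
have c1 : eta (Q `\` q) = 0 by apply: conc => i; case: (tP i).
have c2 : eta' (Q `\` q) = 0 by apply: conc => i; case: (tP i).
have countq (w : Om) D : measurable D -> w (Q `\` q) = 0 ->
    w (D `&` Q) = w (D `&` q).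
  move=> mD w0; rewrite -(setUIDK (D `&` Q) q) measureU//=; last 3 first.
  - by apply: measurableI => //; exact: measurableI.
  - by apply: measurableD => //; exact: measurableI.
  - by apply/seteqP; split => // x [[_ ?] [_ ?]].
  rewrite -setIA (setIidr qQ) [X in _ + X](_ : _ = 0) ?adde0//.
  apply/eqP; rewrite eq_le measure_ge0 andbT -w0; apply: le_measure;
    rewrite ?inE.
  - by apply: measurableD => //; exact: measurableI.
  - exact: measurableD.
  - by move=> x [[_ Qx] nx].
have [x qx] : q !=set0.
  apply/set0P/negP => /eqP q0; move: eta0.
  by rewrite -[Q]setTI (countq eta setT)// q0 setI0 measure0 eqxx.
(* q is an atom: a set in cell_sets that contains the point x contains q. *)
have atom D : cell_sets D -> forall y, q y -> D x -> D y.
  suff H : cell_sets `<=` [set D | forall y z, q y -> q z -> D y -> D z].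
    by move=> /H h y qy; exact: h.
  apply: smallest_sub.
    split=> [//|E hE y z qy qz [_ Ey]|F hF y z qy qz [i _ Fy]].
    - by split => // Ez; apply: Ey; exact: hE qz qy Ez.
    - by exists i => //; exact: hF i y z qy qz Fy.
  move=> _ [[k _ <-]|->] y z qy qz.
    apply: (cell_agree (qy k.+1 I) (qz k.+1 I)).
    by rewrite size_cat; have [-> _ _ _ _] := tP k.+1; rewrite ltnS leq_addr.
  by move=> _; apply: cell_sub (qz 0%N I).
have Qfin (w : Om) : w Q < +oo.
  by apply: le_lt_trans (Wfin w); apply: le_measure; rewrite ?inE//;
    exact: cell_sub.
have collapsed (w : Om) D : w (Q `\` q) = 0 -> cell_sets D ->
    w (D `&` Q) = collapse mQ x (Qfin w) D.
  move=> w0 FD; have mD := cell_sets_measurable FD.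
  rewrite collapseE countq//; case: ifPn => [/set_mem Dx|/negP Dx].
    rewrite (setIidr (_ : q `<=` D)).
      by rewrite -[Q]setTI countq// setTI.
    by move=> y qy; exact: atom Dx.
  rewrite (_ : D `&` q = set0) ?measure0//; apply/seteqP; split => // y [Dy qy].
  apply: Dx; apply/mem_set; apply: contrapT => nDx.
  have := atom (~` D) _ y qy nDx; apply => //.
  exact: (@measurableC _ (g_sigma_algebraType (range C `|` [set W]))).
have fE (w : Om) : w (Q `\` q) = 0 -> f (mixture (mcell s) omega w) =
    f (superposition (restriction (measurableC mQ) omega)
      (collapse mQ x (Qfin w))).
  move=> w0; apply: depf => D FD.
  by rewrite mixtureE superpositionE restrictionE -collapsed.
rewrite !fE//; apply: incf => D mD.
rewrite !superpositionE; apply: leeD => //.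
by rewrite !collapseE; case: ifP.
Qed.

End comparison.

(** * Covariance under one resampling *)

Section unit_functions.
Context d (O : measurableType d) (R : realType) (P : probability O R).

(** Measurable functions with values in [0, 1]. *)
Definition unit_function (f : O -> \bar R) :=
  measurable_fun setT f /\ forall x, 0 <= f x <= 1.

Lemma unit_function_ge0 f x : unit_function f -> 0 <= f x.
Proof. by move=> [_ /(_ x)/andP[]]. Qed.

Lemma unit_function_le1 f x : unit_function f -> f x <= 1.
Proof. by move=> [_ /(_ x)/andP[]]. Qed.

Lemma unit_functionM f g : unit_function f -> unit_function g ->
  unit_function (fun x => f x * g x).
Proof.
move=> uf ug; split; first by apply: emeasurable_funM;
  [exact: uf.1|exact: ug.1].
move=> x; rewrite mule_ge0 ?unit_function_ge0//= -[leRHS]mule1.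
by apply: lee_pmul; rewrite ?unit_function_ge0 ?unit_function_le1.
Qed.

Lemma unit_function_indic A : measurable A ->
  unit_function (fun x => (\1_A x)%:E).
Proof.
move=> mA; split; first exact/measurable_EFinP/measurable_indic.
by move=> x; rewrite !lee_fin indicE; case: (_ \in _) => /=;
  rewrite ?lexx ler01.
Qed.

Lemma integral_unit_le1 f : unit_function f -> \int[P]_x f x <= 1.
Proof.
move=> uf; apply: (@le_trans _ _ (\int[P]_x (cst 1) x)).
  apply: ge0_le_integral => //.
  - by move=> x _; exact: unit_function_ge0.
  - exact: uf.1.
  - by move=> x _; exact: unit_function_le1.
by rewrite integral_cst//= mul1e probability_setT.
Qed.

Lemma integral_unit_fin f : unit_function f -> \int[P]_x f x \is a fin_num.
Proof.
move=> uf; rewrite ge0_fin_numE.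
  by apply: le_lt_trans (integral_unit_le1 uf) _; exact: ltry.
by apply: integral_ge0 => x _; exact: unit_function_ge0.
Qed.

Lemma rearrangement (a b a' b' : \bar R) :
  0 <= a <= 1 -> 0 <= b <= 1 -> 0 <= a' <= 1 -> 0 <= b' <= 1 ->
  (a <= a' /\ b <= b') \/ (a' <= a /\ b' <= b) ->
  a * b' + a' * b <= a * b + a' * b'.
Proof.
case: a b a' b' => [a||] [b||] [a'||] [b'||] //=; rewrite ?leye_eq ?andbF//.
rewrite !lee_fin => _ _ _ _ h; case: h => -[h1 h2]; nra.
Qed.

Lemma rearrangement_crude (a b a' b' : \bar R) :
  0 <= a <= 1 -> 0 <= b <= 1 -> 0 <= a' <= 1 -> 0 <= b' <= 1 ->
  a * b' + a' * b <= a * b + a' * b' + 1.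
Proof.
case: a b a' b' => [a||] [b||] [a'||] [b'||] //=; rewrite ?leye_eq ?andbF//.
rewrite !lee_fin => /andP[? ?] /andP[? ?] /andP[? ?] /andP[? ?].
nra.
Qed.

Let PP := self_product P.

Lemma integral_self_product (f g : O -> \bar R) :
  unit_function f -> unit_function g ->
  \int[PP]_z (f z.1 * g z.2) = (\int[P]_x f x) * (\int[P]_x g x).
Proof.
move=> uf ug.
have mfg : measurable_fun setT (fun z : O * O => f z.1 * g z.2).
  apply: emeasurable_funM.
    by apply: (measurableT_comp uf.1).
  by apply: (measurableT_comp ug.1).
have fg0 z : 0 <= f z.1 * g z.2 by rewrite mule_ge0// unit_function_ge0.
rewrite [LHS](@fubini_tonelli1 _ _ _ _ _ P P _ mfg fg0) /fubini_F/=.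
rewrite (eq_integral (fun x => (\int[P]_y g y) * f x)).
  rewrite ge0_integralZl//.
  - by rewrite muleC.
  - exact: uf.1.
  - by move=> x _; exact: unit_function_ge0.
  - by apply: integral_ge0 => x _; exact: unit_function_ge0.
move=> x _; rewrite ge0_integralZl//; first by rewrite muleC.
- exact: ug.1.
- by move=> y _; exact: unit_function_ge0.
- exact: unit_function_ge0.
Qed.

(** Chebyshev's association inequality, with an error term: f and g need be
    ordered in the same way at x and y only for pairs (x, y) outside N. *)
Lemma integral_comonotone (f g : O -> \bar R) (N : set (O * O)) :
  unit_function f -> unit_function g -> measurable N ->
  (forall x y, ~ N (x, y) ->
    (f x <= f y /\ g x <= g y) \/ (f y <= f x /\ g y <= g x)) ->
  (\int[P]_x f x) * (\int[P]_x g x) <= \int[P]_x (f x * g x) + PP N.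
Proof.
move=> uf ug mN comon.
have u1 : unit_function (fun=> 1 : \bar R).
  by split => // x; rewrite lexx lee01.
have ufg := unit_functionM uf ug.
have mfst (h : O -> \bar R) : unit_function h ->
    measurable_fun setT (fun z : O * O => h z.1).
  by move=> uh; apply: (measurableT_comp uh.1).
have msnd (h : O -> \bar R) : unit_function h ->
    measurable_fun setT (fun z : O * O => h z.2).
  by move=> uh; apply: (measurableT_comp uh.1).
have mM (h k : O -> \bar R) : unit_function h -> unit_function k ->
    measurable_fun setT (fun z : O * O => h z.1 * k z.2).
  by move=> uh uk; apply: emeasurable_funM; [exact: mfst|exact: msnd].
have M0 (h k : O -> \bar R) x y : unit_function h -> unit_function k ->
    0 <= h x * k y.
  by move=> uh uk; rewrite mule_ge0// unit_function_ge0.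
have I1 : \int[P]_x (1 : \bar R) = 1 by rewrite integral_cst//=
  mul1e probability_setT.
have IN : \int[PP]_z (\1_N z)%:E = PP N by rewrite integral_indic// setIT.
(* Off N this is the rearrangement inequality; on N the difference of the two
   sides is at most 1. *)
have key : \int[PP]_z (f z.1 * g z.2 + g z.1 * f z.2) <=
    \int[PP]_z ((f z.1 * g z.1) * 1 + 1 * (f z.2 * g z.2) + (\1_N z)%:E).
  apply: ge0_le_integral => //.
  - by move=> z _; rewrite adde_ge0// M0.
  - by apply: emeasurable_funD; exact: mM.
  - apply: emeasurable_funD; last exact/measurable_EFinP/measurable_indic.
    apply: emeasurable_funD.
      exact: (mM (fun x => f x * g x) (fun=> 1)).
    exact: (mM (fun=> 1) (fun x => f x * g x)).
  - move=> [x y] _ /=; rewrite mule1 mul1e [g x * f y]muleC.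
    have [fx fy gx gy] := And4 (uf.2 x) (uf.2 y) (ug.2 x) (ug.2 y).
    rewrite indicE; have [xyN|xyN] := boolP ((x, y) \in N).
      exact: rearrangement_crude.
    rewrite adde0; apply: rearrangement => //.
    by apply: comon => Nxy; move: xyN; rewrite mem_set.
move: key.
rewrite ge0_integralD//; last 4 first.
- by move=> z _; exact: M0.
- exact: mM.
- by move=> z _; exact: M0.
- exact: mM.
rewrite ge0_integralD//; last 3 first.
- by move=> z _; apply: adde_ge0; apply: mule_ge0 => //;
    exact: (unit_function_ge0 _ ufg).
- apply: emeasurable_funD.
    exact: (mM (fun x => f x * g x) (fun=> 1)).
  exact: (mM (fun=> 1) (fun x => f x * g x)).
- exact/measurable_EFinP/measurable_indic.
rewrite ge0_integralD//; last 4 first.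
- by move=> z _; apply: mule_ge0 => //; exact: (unit_function_ge0 _ ufg).
- exact: (mM (fun x => f x * g x) (fun=> 1)).
- by move=> z _; apply: mule_ge0 => //; exact: (unit_function_ge0 _ ufg).
- exact: (mM (fun=> 1) (fun x => f x * g x)).
rewrite IN !integral_self_product//.
rewrite (integral_self_product (f := fun x => f x * g x) (g := fun=> 1))//.
rewrite (integral_self_product (f := fun=> 1) (g := fun x => f x * g x))//.
rewrite I1 !mul1e mule1.
rewrite [X in _ + X <= _]muleC.
have := integral_unit_fin uf; have := integral_unit_fin ug.
have := integral_unit_fin ufg.
have : PP N \is a fin_num by exact: fin_num_measure.
have : 0 <= PP N by exact: measure_ge0.
move: (\int[P]_x f x) (\int[P]_x g x) (\int[P]_x (f x * g x)) (PP N).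
move=> [a||] [b||] [c||] [n||] //; rewrite -?EFinM -?EFinD !lee_fin; nra.
Qed.

End unit_functions.

Section resample.
Context d (O : measurableType d) (R : realType) (P : probability O R).
Implicit Types f g : O -> \bar R.
Variable mix : O * O -> O.
Hypothesis mmix : measurable_fun setT mix.
Hypothesis mix_law : forall A, measurable A ->
  self_product P (mix @^-1` A) = P A.

(** The mean of f after resampling: for mix (x, y) the configuration x in
    which the trajectories of some set are replaced by those of y, it is the
    conditional expectation of f given the other trajectories. *)
Definition resample (f : O -> \bar R) (x : O) : \bar R :=
  \int[P]_y f (mix (x, y)).

Lemma unit_function_mix f x : unit_function f ->
  unit_function (fun y => f (mix (x, y))).
Proof.
move=> uf; split; last by move=> y; exact: uf.2.
apply: (measurableT_comp uf.1); apply: (measurableT_comp mmix).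
exact: measurable_fun_pair.
Qed.

Lemma unit_function_resample f : unit_function f -> unit_function (resample f).
Proof.
move=> uf; split; last first.
  move=> x; rewrite integral_unit_le1 ?andbT; last exact: unit_function_mix.
  by apply: integral_ge0 => y _; exact: unit_function_ge0.
apply: (measurable_fun_fubini_tonelli_F (m2 := P) (f \o mix)).
  exact: measurableT_comp uf.1 mmix.
by move=> z; exact: (unit_function_ge0 _ uf).
Qed.

Lemma integral_resample f : unit_function f ->
  \int[P]_x resample f x = \int[P]_x f x.
Proof.
move=> uf.
have mf : measurable_fun setT (f \o mix) by exact: measurableT_comp uf.1 mmix.
have f0 z : 0 <= (f \o mix) z by exact: (unit_function_ge0 _ uf).
rewrite -[LHS](@fubini_tonelli1 _ _ _ _ _ P P _ mf f0).
have := ge0_integral_pushforward mmix (self_product P) measurableT uf.1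
  (fun x _ => unit_function_ge0 x uf).
rewrite preimage_setT => <-.
by apply: eq_measure_integral => A mA _; exact: mix_law.
Qed.

Lemma resampleD f g x : unit_function f -> unit_function g ->
  resample (fun y => f y + g y) x = resample f x + resample g x.
Proof.
move=> uf ug; rewrite /resample ge0_integralD//.
- by move=> y _; exact: unit_function_ge0.
- exact: (unit_function_mix x uf).1.
- by move=> y _; exact: unit_function_ge0.
- exact: (unit_function_mix x ug).1.
Qed.

(** Resampling f and g separately cannot raise the mean of their product by
    more than self_product P N: given the part x that is kept, the covariance
    of f and g is at least the opposite of this error. *)
Lemma integral_resampleM f g N : unit_function f -> unit_function g ->
  measurable N ->
  (forall x y z, ~ N (y, z) ->
    (f (mix (x, y)) <= f (mix (x, z)) /\ g (mix (x, y)) <= g (mix (x, z))) \/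
    (f (mix (x, z)) <= f (mix (x, y)) /\ g (mix (x, z)) <= g (mix (x, y)))) ->
  \int[P]_x (resample f x * resample g x) <=
  \int[P]_x (f x * g x) + self_product P N.
Proof.
move=> uf ug mN comon.
have ufg := unit_functionM uf ug.
rewrite -(integral_resample ufg).
have -> : self_product P N = \int[P]_x cst (self_product P N) x.
  by rewrite integral_cst//= probability_setT mule1.
rewrite -ge0_integralD//; last 2 first.
- by move=> x _; apply: unit_function_ge0; exact: unit_function_resample.
- exact: (unit_function_resample ufg).1.
apply: ge0_le_integral => //.
- by move=> x _; apply: mule_ge0; apply: unit_function_ge0;
    exact: unit_function_resample.
- by apply: (unit_functionM _ _).1; exact: unit_function_resample.
- by apply: emeasurable_funD => //; exact: (unit_function_resample ufg).1.
- move=> x _; apply: integral_comonotone => //; try exact: unit_function_mix.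
  by move=> y z; exact: comon.
Qed.

End resample.

(** * Resampling all cells of a partition *)

Section iterated_resampling.
Variables (R : realType) (V : pcountType) (G : weighted_graph R V)
  (X : transient_chain G).
Local Notation T := (trajectory_class X).
Local Notation Om := (configuration X).
Variables (nu : {measure set T -> \bar R}) (P : probability Om R).
Hypothesis poiP : is_poisson_process nu P.
Variables (W : set T) (C : nat -> set T).
Hypotheses (mW : measurable W) (mC : forall k, measurable (C k)).
Hypotheses (Wfin : forall omega : Om, omega W < +oo) (nuW : nu W < +oo).
Implicit Types f g h u : Om -> \bar R.

Lemma split_event_le s :
  self_product P (split_event W C s) <= (split_mass W C nu s)%:E.
Proof.
have mcell t : measurable (cell W C t) by exact: measurable_cell.
have hitle b b' : self_product P (hit W C (b :: s) `*` hit W C (b' :: s)) <=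
    (cell_mass W C nu (b :: s) * cell_mass W C nu (b' :: s))%R%:E.
  rewrite self_productE; try exact: measurable_hit.
  rewrite EFinM -!cell_massE//.
  by apply: lee_pmul => //; apply: (poisson_hit_le poiP).
apply: le_trans (measureU2 _ _ _) _.
- by apply: measurableX; exact: measurable_hit.
- by apply: measurableX; exact: measurable_hit.
apply: le_trans (leeD (hitle true false) (hitle false true)) _.
by rewrite -EFinD lee_fin /split_mass; lra.
Qed.

Lemma separated_le s : self_product P (separated W C s) <=
  \sum_(0 <= j <oo) (\sum_(t <- codes j) split_mass W C nu (t ++ s))%R%:E.
Proof.
have mfin j : measurable
  (\big[setU/set0]_(t <- codes j) split_event W C (t ++ s)).
  by apply: bigsetU_measurable => t _; exact: measurable_split_event.
apply: (@le_trans _ _ (\sum_(j <oo) self_product P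
    (\big[setU/set0]_(t <- codes j) split_event W C (t ++ s)))).
  by apply: measure_sigma_subadditive => //; exact: measurable_separated.
apply: lee_nneseries => [j _ _|j _]; first exact: measure_ge0.
elim: (codes j) => [|t l IH]; first by rewrite !big_nil measure0.
rewrite !big_cons EFinD; apply: le_trans (measureU2 _ _ _) _.
- exact: measurable_split_event.
- by apply: bigsetU_measurable => ? _; exact: measurable_split_event.
- by apply: leeD => //; exact: split_event_le.
Qed.

Let mcell s := measurable_cell mW mC s.
Let mix s (p : Om * Om) := mixture (mcell s) p.1 p.2.
Let mmix s : measurable_fun setT (mix s).
Proof. exact: measurable_mixture. Qed.
Let mix_law s A : measurable A -> self_product P (mix s @^-1` A) = P A.
Proof. by apply: mixture_law; exact: poisson_independent poiP. Qed.

Lemma monotone_resample s f : unit_function f -> monotone_functional f ->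
  monotone_functional (resample P (mix s) f).
Proof.
move=> uf incf w v wv; apply: ge0_le_integral => //.
- by move=> y _; exact: unit_function_ge0.
- exact: (unit_function_mix (mmix s) w uf).1.
- exact: (unit_function_mix (mmix s) v uf).1.
- move=> y _; apply: incf => D mD; rewrite /mix/= !mixtureE leeD//.
  by apply: wv; exact: measurableD.
Qed.

Lemma depends_on_resample F F' s f : (forall D, F D -> F' (D `\` cell W C s)) ->
  depends_on F f -> depends_on F' (resample P (mix s) f).
Proof.
move=> FF' df w v wv; apply: eq_integral => y _.
by apply: df => D /FF' FD; rewrite /mix/= !mixtureE wv.
Qed.

(** The successive resampling of the cells listed in l. *)
Definition resample_cells (l : seq (seq bool)) f : Om -> \bar R :=
  foldr (fun s h => resample P (mix s) h) f l.

Lemma unit_function_resample_cells l f :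
  unit_function f -> unit_function (resample_cells l f).
Proof. by move=> uf; elim: l => //= s l IH; exact: unit_function_resample. Qed.

Lemma integral_resample_cells l f : unit_function f ->
  \int[P]_w resample_cells l f w = \int[P]_w f w.
Proof.
move=> uf; elim: l => //= s l <-.
exact (integral_resample (mmix s) (@mix_law s)
  (unit_function_resample_cells l uf)).
Qed.

Lemma monotone_resample_cells l f : unit_function f -> monotone_functional f ->
  monotone_functional (resample_cells l f).
Proof.
move=> uf incf; elim: l => //= s l IH.
by apply: monotone_resample => //; exact: unit_function_resample_cells.
Qed.

Lemma depends_on_resample_cells l f : depends_on (cell_sets W C) f ->
  depends_on (cell_sets W C) (resample_cells l f).
Proof.
move=> df; elim: l => //= s l IH; apply: depends_on_resample IH => D FD.
by apply: cell_sets_setD => //; exact: cell_sets_cell.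
Qed.

Lemma resample_cells_subadditive l f u h : unit_function f -> unit_function u ->
  unit_function h -> (forall w, h w <= f w + u w) ->
  forall w, resample_cells l h w <= resample_cells l f w + resample_cells l u w.
Proof.
move=> uf uu uh hfu; elim: l => //= s l IH w.
have [ufl uul uhl] := And3 (unit_function_resample_cells l uf)
  (unit_function_resample_cells l uu) (unit_function_resample_cells l uh).
rewrite -(resampleD P (mmix s))//; apply: ge0_le_integral => //.
- by move=> y _; exact: unit_function_ge0.
- exact: (unit_function_mix (mmix s) w uhl).1.
- apply: emeasurable_funD.
    exact: (unit_function_mix (mmix s) w ufl).1.
  exact: (unit_function_mix (mmix s) w uul).1.
Qed.

(** Resampling all cells of a partition of W leaves nothing of a function of the
    trajectories in W but its mean. *)
Lemma resample_cells_local n h : unit_function h ->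
  depends_on (local_sets W) h ->
  forall w, resample_cells (codes n) h w = \int[P]_v h v.
Proof.
move=> uh dh w.
pose rest l := foldr (fun s D => D `\` cell W C s) W l.
(* Each resampling removes its cell from the set on which h depends. *)
have dl l : depends_on (local_sets (rest l)) (resample_cells l h).
  elim: l => //= s l IH; apply: depends_on_resample IH => D [mD Dl]; split.
    exact: measurableD.
  by move=> x [Dx sx]; split => //; exact: Dl.
have rest0 : rest (codes n) = set0.
  apply/seteqP; split => // x xr.
  have restP l : rest l x -> W x /\ forall s, s \in l -> ~ cell W C s x.
    elim: l => [//|s l IH] /= [/IH[Wx nl] ns]; split => // t.
    by rewrite inE => /orP[/eqP ->|/nl].
  have [Wx nx] := restP _ xr.
  by have [s sn /(nx s sn)] := cell_cover C n Wx.
rewrite -(integral_resample_cells (codes n) uh).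
rewrite (eq_integral (cst (resample_cells (codes n) h w))).
  by rewrite integral_cst//= probability_setT mule1.
move=> v _; apply: dl => D [_]; rewrite rest0 subset0 => ->.
by rewrite !measure0.
Qed.

Lemma integral_resample_cellsM l f g :
  unit_function f -> monotone_functional f -> depends_on (cell_sets W C) f ->
  unit_function g -> monotone_functional g -> depends_on (cell_sets W C) g ->
  \int[P]_w (resample_cells l f w * resample_cells l g w) <=
  \int[P]_w (f w * g w) + \sum_(s <- l) self_product P (separated W C s).
Proof.
move=> uf mf df ug mg dg; elim: l => [|s l IH]; first by rewrite big_nil adde0.
rewrite big_cons addeCA addeC.
apply: (le_trans _ (leeD2r _ IH)).
apply: (integral_resampleM (mmix s) (@mix_law s)).
- exact: unit_function_resample_cells.
- exact: unit_function_resample_cells.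
- exact: measurable_separated.
move=> w y z ns.
have [yz|/ltW zy] := leP (y (cell W C s)) (z (cell W C s)); [left|right].
  split; (apply: (comparable_of_not_separated mW mC Wfin ns yz);
    [exact: monotone_resample_cells|exact: depends_on_resample_cells]).
have ns' : ~ separated W C s (z, y).
  move=> [i _ zyi]; apply: ns; exists i => //; move: zyi.
  by rewrite -!bigcup_seq => -[t tl st]; exists t => //; case: st => -[? ?];
    [right|left].
split; (apply: (comparable_of_not_separated mW mC Wfin ns' zy);
  [exact: monotone_resample_cells|exact: depends_on_resample_cells]).
Qed.

End iterated_resampling.

(** * The inequality *)

(** Used for p = P A', q = P B', with a, b the resampled indicators of A and B
    and u, v those of the differences A' minus A and B' minus B. *)
Lemma unit_product_le (R : realType) (p q a b u v : \bar R) :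
  0 <= p <= 1 -> 0 <= q <= 1 -> 0 <= a <= 1 -> 0 <= b <= 1 ->
  0 <= u <= 1 -> 0 <= v <= 1 -> p <= a + u -> q <= b + v ->
  p * q <= a * b + (u + v).
Proof.
case: p q a b u v => [p||] [q||] [a||] [b||] [u||] [v||] //=;
  rewrite ?leye_eq ?andbF//.
rewrite !lee_fin => /andP[? ?] /andP[? ?] /andP[? ?] /andP[? ?] /andP[? ?]
  /andP[? ?].
move=> h1 h2; nra.
Qed.

Section fkg.
Variables (R : realType) (V : pcountType) (G : weighted_graph R V)
  (X : transient_chain G).
Local Notation T := (trajectory_class X).
Local Notation Om := (configuration X).
Variables (nu : {measure set T -> \bar R}) (P : probability Om R).
Hypothesis poiP : is_poisson_process nu P.
Variables (A B : set Om).
Hypotheses (mA : measurable A) (mB : measurable B).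
Hypotheses (iA : increasing_event A) (iB : increasing_event B).

Lemma monotone_indic D : increasing_event D ->
  monotone_functional (fun w : Om => (\1_D w)%:E : \bar R).
Proof.
move=> iD w v wv; rewrite lee_fin !indicE.
have [wD|] := boolP (w \in D); last by case: (v \in D) => //=; rewrite ler01.
by rewrite (mem_set (iD _ _ (set_mem wD) wv)).
Qed.

Lemma depends_on_indic F D : depends_on F D ->
  depends_on F (fun w : Om => (\1_D w)%:E : \bar R).
Proof.
move=> dD w v /dD h; rewrite !indicE.
congr (_ %:R%:E); congr nat_of_bool.
by apply/idP/idP; rewrite !inE h.
Qed.

(** The inequality with error terms, for local approximations A' and B' of A and
    B. *)
Lemma fkg_approx (e : R) : (0 < e)%R ->
  exists A' B' : set Om, [/\ measurable A', measurable B',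
    P (A `\` A' `|` A' `\` A) <= e%:E, P (B `\` B' `|` B' `\` B) <= e%:E &
    P A' * P B' <= P (A `&` B) + e%:E + (P (A' `\` A) + P (B' `\` B))].
Proof.
move=> e0.
have [n1 [A' [mA' dA' PA']]] := measurable_approximable poiP mA e0.
have [n2 [B' [mB' dB' PB']]] := measurable_approximable poiP mB e0.
exists A', B'; split => //.
have [CA [mCA dA]] := depends_on_countable mA.
have [CB [mCB dB]] := depends_on_countable mB.
(* The counts on which A and B depend, interlaced in one sequence. *)
pose C k := if odd k then CB k./2 else CA k./2.
have mC k : measurable (C k) by rewrite /C; case: ifP.
pose n := maxn n1 n2; pose W := exhaustion X n.
have mW : measurable W by exact: measurable_exhaustion.
have Wfin (w : Om) : w W < +oo.
  by apply: configuration_finite; exact: finite_exhaustion.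
have nuW : nu W < +oo.
  by apply: (poisson_intensity_finite poiP); exact: finite_exhaustion.
have cA : depends_on (cell_sets W C) A.
  apply: depends_on_sub dA => _ [k _ <-]; apply: sub_sigma_algebra; left.
  by exists k.*2 => //; rewrite /C odd_double doubleK.
have cB : depends_on (cell_sets W C) B.
  apply: depends_on_sub dB => _ [k _ <-]; apply: sub_sigma_algebra; left.
  by exists k.*2.+1 => //; rewrite /C /= odd_double uphalf_double.
have lA : depends_on (local_sets W) A'.
  apply: depends_on_sub dA' => D [mD Dn]; split => //.
  by apply: subset_trans Dn _; apply: exhaustion_subset; exact: leq_maxl.
have lB : depends_on (local_sets W) B'.
  apply: depends_on_sub dB' => D [mD Dn]; split => //.
  by apply: subset_trans Dn _; apply: exhaustion_subset; exact: leq_maxr.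
have [m sm] := small_split_mass mW mC nuW e0.
pose S := resample_cells P mW mC (codes m).
pose ind (D : set Om) (w : Om) : \bar R := (\1_D w)%:E.
have uA := unit_function_indic R mA; have uB := unit_function_indic R mB.
have uS D : measurable D -> unit_function (S (ind D)).
  by move=> mD; apply: unit_function_resample_cells; exact: unit_function_indic.
have intS D : measurable D -> \int[P]_w S (ind D) w = P D.
  move=> mD; rewrite (integral_resample_cells poiP mW mC)//.
    by rewrite integral_indic// setIT.
  exact: unit_function_indic.
have constS D : measurable D -> depends_on (local_sets W) D ->
    forall w, S (ind D) w = P D.
  move=> mD dD w; rewrite /S (resample_cells_local poiP mW mC)//.
  - by rewrite integral_indic// setIT.
  - exact: unit_function_indic.
  - exact: depends_on_indic.
have covS D D' : measurable D -> measurable D' ->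
    forall w, S (ind D') w <= S (ind D) w + S (ind (D' `\` D)) w.
  move=> mD mD' w; apply: resample_cells_subadditive;
    try (by apply: unit_function_indic => //; exact: measurableD).
  move=> v; rewrite /ind -EFinD lee_fin !indicE in_setD.
  by case: (v \in D') (v \in D) => [] [] /=; rewrite ?addr0 ?add0r ?lexx ?ler01.
have mDA : measurable (A' `\` A) by exact: measurableD.
have mDB : measurable (B' `\` B) by exact: measurableD.
(* P A' and P B' are the values of the constant functions S (ind A') and
   S (ind B'). *)
have le1 : P A' * P B' <= \int[P]_w (S (ind A) w * S (ind B) w +
    (S (ind (A' `\` A)) w + S (ind (B' `\` B)) w)).
  have -> : P A' * P B' = \int[P]_w cst (P A' * P B') w.
    by rewrite integral_cst//= probability_setT mule1.
  apply: ge0_le_integral => //.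
  - by move=> w _; rewrite mule_ge0.
  - apply: emeasurable_funD;
      first by apply: (unit_functionM (uS _ mA) (uS _ mB)).1.
    by apply: emeasurable_funD; [exact: (uS _ mDA).1|exact: (uS _ mDB).1].
  - move=> w _ /=; apply: unit_product_le; try exact: (uS _ _).2.
    + by rewrite measure_ge0 probability_le1.
    + by rewrite measure_ge0 probability_le1.
    + by rewrite -(constS _ mA' lA w); exact: covS.
    + by rewrite -(constS _ mB' lB w); exact: covS.
apply: (le_trans le1).
rewrite ge0_integralD//; last 4 first.
- by move=> w _; apply: mule_ge0; apply: unit_function_ge0; exact: uS.
- by apply: (unit_functionM _ _).1; exact: uS.
- by move=> w _; apply: adde_ge0; apply: unit_function_ge0; exact: uS.
- by apply: emeasurable_funD; apply: (uS _ _).1.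
rewrite ge0_integralD//; last 4 first.
- by move=> w _; apply: unit_function_ge0; exact: uS.
- exact: (uS _ mDA).1.
- by move=> w _; apply: unit_function_ge0; exact: uS.
- exact: (uS _ mDB).1.
rewrite !intS//; apply: leeD => //.
apply: (le_trans (integral_resample_cellsM poiP mW mC Wfin (codes m)
  uA (monotone_indic iA) (depends_on_indic cA)
  uB (monotone_indic iB) (depends_on_indic cB))).
apply: leeD.
  have -> : P (A `&` B) = \int[P]_w ind (A `&` B) w.
    by rewrite integral_indic ?setIT//; exact: measurableI.
  rewrite (eq_integral (ind (A `&` B)))// => w _.
  by rewrite /ind -EFinM indicI.
apply: le_trans sm; apply: lee_sum => s _.
exact: separated_le.
Qed.

Lemma poisson_fkg : P A * P B <= P (A `&` B).
Proof.
have finP D : measurable D -> exists2 r : R, P D = r%:E & (0 <= r)%R.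
  move=> mD; have PD := fin_num_measure P _ mD.
  by exists (fine (P D)); rewrite ?fineK ?fine_ge0.
have [a aE a0] := finP _ mA.
have [b bE b0] := finP _ mB.
have [c cE c0] := finP _ (measurableI _ _ mA mB).
rewrite aE bE cE -EFinM lee_fin; apply/ler_addgt0Pr => e e0.
(* The errors add up to at most 5 * d + d ^+ 2 <= 6 * d. *)
pose d := Num.min 1%R (e / 6)%R.
have d0 : (0 < d)%R by rewrite lt_min ltr01 divr_gt0.
have d1 : (d <= 1)%R by rewrite ge_min lexx.
have de : (6 * d <= e)%R.
  have : (d <= e / 6)%R by rewrite ge_min lexx orbT.
  lra.
have [A' [B' [mA' mB' PA PB]]] := fkg_approx d0.
have [a' a'E a'0] := finP _ mA'.
have [b' b'E b'0] := finP _ mB'.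
have approx D D' : measurable D -> measurable D' ->
    P (D `\` D' `|` D' `\` D) <= d%:E ->
    P D <= P D' + d%:E /\ P (D' `\` D) <= d%:E.
  move=> mD mD' h; have mDD' : measurable (D `\` D') by exact: measurableD.
  have mD'D : measurable (D' `\` D) by exact: measurableD.
  split; last first.
    by apply: le_trans h; apply: le_measure; rewrite ?inE//; exact: measurableU.
  apply: le_trans (leeD2l _ h).
  apply: le_trans (measureU2 P mD' (measurableU _ _ mDD' mD'D)).
  apply: le_measure; rewrite ?inE//; first by apply: measurableU => //;
    exact: measurableU.
  by move=> w Dw; have [D'w|D'w] := pselect (D' w); [left|right; left].
have [PA1 PA2] := approx _ _ mA mA' PA.
have [PB1 PB2] := approx _ _ mB mB' PB.
move=> h; have {}h := le_trans h (leeD2l _ (leeD PA2 PB2)).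
have a1 : P A' <= 1 by exact: probability_le1.
have b1 : P B' <= 1 by exact: probability_le1.
move: h a1 b1 PA1 PB1; rewrite aE bE cE a'E b'E -EFinM -!EFinD !lee_fin.
move=> h a1 b1 PA1 PB1; nra.
Qed.

End fkg.

Theorem theorem3 (R : realType) (V : pcountType) (G : weighted_graph R V)
    (X : transient_chain G) (P : probability (configuration X) R)
    (hP : is_interlacement_law P) (A B : set (configuration X))
    (mA : measurable A) (mB : measurable B)
    (iA : increasing_event A) (iB : increasing_event B) :
  P A * P B <= P (A `&` B).
Proof. by have [nu _ poiP] := hP; exact: (poisson_fkg poiP). Qed.
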